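(* Let $d\ge 1$, let $\vartheta>0$, and let $\Phi(N,n)$ be complex weights ($N\ge 1$ integer, $n\in\mathbb Z$) such that for every $N$ the function $n\mapsto\Phi(N,n)$ has bounded support and $\sum_{n=-\infty}^{+\infty}\Phi(N,n)=1$. Assume that there exist $H>0$ and an infinite set of positive integers $N$ for which, for every $t\in\mathbb R$, the sum $\sum_{n}\Phi(N,n)e^{2\pi i n t}$ is real and $$\sum_{n=-\infty}^{+\infty}\Phi(N,n)e^{2\pi i n t}\ge H(1+N\|t\|)^{-\vartheta}.$$ (i) If $0<\delta<d\vartheta-d/2$, then there exists a function $f$ in the Sobolev space $W^{\delta,2}(\mathbb T^d)$ such that, for every $\alpha\in\mathbb R^d$, $$\limsup_{N\to+\infty}\left\{N^{\vartheta}\sup_{x\in\mathbb T^d}\left|\mathcal D_N^{\Phi,\alpha}f(x)\right|\right\}=+\infty.$$ (ii) If $\vartheta>1/2$, there exists a function $f$ in the Sobolev space $W^{d\vartheta-\frac d2,2}(\mathbb T^d)$ such that, for almost every $\alpha\in\mathbb R^d$, $$\limsup_{N\to+\infty}\left\{N^{\vartheta}\sup_{x\in\mathbb T^d}\left|\mathcal D_N^{\Phi,\alpha}f(x)\right|\right\}=+\infty.$$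
   Context: $\mathbb T^d=\mathbb R^d/\mathbb Z^d$; functions on $\mathbb T^d$ are identified with $\mathbb Z^d$-periodic functions on $\mathbb R^d$. For real $t$, $\|t\|=\inf_{n\in\mathbb Z}|t-n|$. Fourier coefficients: $\widehat f(m)=\int_{\mathbb T^d}f(x)e^{-2\pi i m\cdot x}dx$, $m\in\mathbb Z^d$. For $\delta>0$, $W^{\delta,2}(\mathbb T^d)$ is the space of distributions on $\mathbb T^d$ with $\|f\|_{\delta,2}=\left(\sum_{m\in\mathbb Z^d}(1+|m|^2)^\delta|\widehat f(m)|^2\right)^{1/2}<\infty$. Since elements of this space are defined up to null sets, the supremum is understood as an essential supremum (it is the ordinary supremum for the continuous representative when there is one). The weighted discrepancy is $$\mathcal D_N^{\Phi,\alpha}f(x)=\sum_{n=-\infty}^{+\infty}\Phi(N,n)f(x+n\alpha)-\int_{\mathbb T^d}f(y)\,dy .$$ *)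

(* Defs.v *)
From HB Require Import structures.
From mathcomp Require Import all_boot all_order all_algebra.
From mathcomp Require Import all_classical all_reals all_analysis.
From mathcomp Require Import ess_sup_inf.
From mathcomp Require Export complex.

Set Implicit Arguments.
Unset Strict Implicit.
Unset Printing Implicit Defensive.

Import Order.TTheory GRing.Theory Num.Theory.
Import numFieldNormedType.Exports.

Local Open Scope classical_set_scope.
Local Open Scope ring_scope.

(* Points of R^d.  [measurableTypeR R] is R with its Borel sigma-algebra, so
   that R^d carries the library's product (= Borel) sigma-algebra on tuples. *)
Notation euclid R d := (d.-tuple (measurableTypeR R)).

Section lebesgue_step.
Context (R : realType) (n : nat).

Definition tuple_of_pair (p : measurableTypeR R * euclid R n) : euclid R n.+1 :=
  [tuple of p.1 :: p.2].

Lemma measurable_tuple_of_pair : measurable_fun [set: _] tuple_of_pair.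
Proof. exact: measurable_cons. Qed.

Definition pair_of_tuple (t : euclid R n.+1) : measurableTypeR R * euclid R n :=
  (thead t, [tuple of behead t]).

Lemma measurable_pair_of_tuple : measurable_fun [set: _] pair_of_tuple.
Proof.
apply/measurable_fun_pairP; split.
  exact: (@measurable_tnth _ (measurableTypeR R) n.+1 ord0).
exact: measurable_behead.
Qed.

Lemma tuple_of_pairK : cancel tuple_of_pair pair_of_tuple.
Proof. by move=> [x t]; congr (_, _) => //; exact: val_inj. Qed.

Lemma pair_of_tupleK : cancel pair_of_tuple tuple_of_pair.
Proof. by move=> t; rewrite [RHS]tuple_eta. Qed.

Variable mu : {sigma_finite_measure set (euclid R n) -> \bar R}.

Definition lebesgue_step : set (euclid R n.+1) -> \bar R :=
  pushforward (@lebesgue_measure R \x mu)%E tuple_of_pair.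

Let nu : {measure set (euclid R n.+1) -> \bar R} :=
  measure_function_pushforward__canonical__measure_function_Measure
    (@lebesgue_measure R \x mu)%E measurable_tuple_of_pair.

Let lebesgue_step0 : lebesgue_step set0 = 0%E.
Proof. exact: (measure0 nu). Qed.

Let lebesgue_step_ge0 A : (0 <= lebesgue_step A)%E.
Proof. exact: (measure_ge0 nu). Qed.

Let lebesgue_step_sigma_additive : semi_sigma_additive lebesgue_step.
Proof. exact: (@measure_semi_sigma_additive _ _ _ nu). Qed.

HB.instance Definition _ := isMeasure.Build _ _ _ lebesgue_step
  lebesgue_step0 lebesgue_step_ge0 lebesgue_step_sigma_additive.

(* The library's sigma-finite instance on [m1 \x m2] is shadowed by the one for
   subprobabilities, hence a direct proof. *)
Let lebesgue_step_sigma_finite : sigma_finite setT lebesgue_step.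
Proof.
have /sigma_finiteP[F [TF ndF Foo]] := sigma_finiteT (@lebesgue_measure R).
have /sigma_finiteP[G [TG ndG Goo]] := sigma_finiteT mu.
exists (fun k => pair_of_tuple @^-1` (F k `*` G k)).
  rewrite -preimage_bigcup (_ : \bigcup_k _ = setT) ?preimage_setT//.
  rewrite -setXTT TF TG predeqE => -[x y]; split.
    by move=> [k _ []/= ? ?]; split; exists k.
  move=> [/= [k _ Fkx] [l _ Gly]]; exists (maxn k l) => //; split.
  - by move: x Fkx; exact/subsetPset/ndF/leq_maxl.
  - by move: y Gly; exact/subsetPset/ndG/leq_maxr.
move=> k; have [mF ?] := Foo k; have [mG ?] := Goo k; split.
  rewrite -[X in measurable X]setTI; apply: measurable_pair_of_tuple => //.
  exact: measurableX.
rewrite /lebesgue_step /pushforward -comp_preimage.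
rewrite (_ : pair_of_tuple \o _ = id); last exact/funext/tuple_of_pairK.
by rewrite [X in (X < _)%E]product_measure1E// lte_mul_pinfty// ge0_fin_numE.
Qed.

HB.instance Definition _ := Measure_isSigmaFinite.Build _ _ _ lebesgue_step
  lebesgue_step_sigma_finite.

End lebesgue_step.

Fixpoint lebesgue_euclid (R : realType) (d : nat) :
    {sigma_finite_measure set (euclid R d) -> \bar R} :=
  if d is d'.+1 then lebesgue_step (lebesgue_euclid R d')
  else dirac (nil_tuple (measurableTypeR R)).

(* This property on boxes characterises Lebesgue measure on R^d. *)
Lemma lebesgue_euclid_box (R : realType) (d : nat)
    (B : 'I_d -> set (measurableTypeR R)) : (forall i, measurable (B i)) ->
  lebesgue_euclid R d [set x | forall i, B i (tnth x i)] =
    (\prod_(i < d) @lebesgue_measure R (B i))%E.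
Proof.
elim: d B => [|d IH] B mB.
  rewrite big_ord0 /= diracE mem_set//= => i; by case: i.
rewrite big_ord_recl -IH//= /lebesgue_step /pushforward.
set C := [set x | forall i : 'I_d, _].
rewrite (_ : _ @^-1` _ = B ord0 `*` C).
  apply: product_measure1E => //; rewrite (_ : C = \bigcap_(i : 'I_d)
    ((fun x : euclid R d => tnth x i) @^-1` B (lift ord0 i))).
    apply: fin_bigcap_measurable => // i _.
    by rewrite -[X in measurable X]setTI; exact: measurable_tnth.
  by apply/seteqP; split=> x Cx i *; exact: Cx.
apply/seteqP; split=> -[x t] /= h.
  split; first exact: (h ord0).
  by move=> i; have := h (lift ord0 i); rewrite tnthS.
move=> i; case: (unliftP ord0 i) => [j|] ->; last exact: h.1.
by rewrite tnthS; exact: h.2.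
Qed.

Section torus.
Context (R : realType) (d : nat).
Implicit Types (x a : euclid R d) (m : d.-tuple int) (f : euclid R d -> R[i]).

Definition eadd x a : euclid R d :=
  [tuple (tnth x i : R) + (tnth a i : R) | i < d].

Definition emulz a (n : int) : euclid R d := [tuple (tnth a i : R) *~ n | i < d].

Definition of_intvec m : euclid R d := [tuple (tnth m i)%:~R : R | i < d].

Definition edot x a : R := \sum_(i < d) (tnth x i : R) * (tnth a i : R).

(* Z^d-periodicity: the functions on T^d are the periodic functions on R^d. *)
Definition periodic f := forall m x, f (eadd x (of_intvec m)) = f x.

Definition unit_cube : set (euclid R d) :=
  [set x | forall i, `[0, 1[%classic (tnth x i : R)].

Lemma measurable_unit_cube : measurable unit_cube.
Proof.
rewrite (_ : unit_cube = \bigcap_(i : 'I_d)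
  ((fun x : euclid R d => tnth x i) @^-1` (`[0, 1[%classic : set R))).
  apply: fin_bigcap_measurable => // i _; rewrite -[X in measurable X]setTI.
  exact: measurable_tnth (measurable_itv _).
by apply/seteqP; split=> x Qx i *; exact: Qx.
Qed.

(* Normalised Haar measure on T^d, seen on the fundamental domain [0, 1)^d;
   on periodic functions its integral, its essential supremum and its null sets
   are those of T^d. *)
Definition torus_measure : {measure set (euclid R d) -> \bar R} :=
  mrestr (lebesgue_euclid R d) measurable_unit_cube.

(* [complex.Re] and [complex.Im] are R-valued, unlike ssrnum's ['Re], ['Im]. *)
Definition torus_integral f : R[i] :=
  Complex (\int[torus_measure]_x complex.Re (f x)) (\int[torus_measure]_x complex.Im (f x)).

Definition torus_integrable f :=
  torus_measure.-integrable setT (fun x => (complex.Re (f x))%:E) /\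
  torus_measure.-integrable setT (fun x => (complex.Im (f x))%:E).

(* t |-> exp (2 pi i t). *)
Definition expi2pi (t : R) : R[i] := Complex (cos (2 * pi * t)) (sin (2 * pi * t)).

Definition fourier_coef f m : R[i] :=
  torus_integral (fun x => f x * expi2pi (- edot (of_intvec m) x)).

(* The W^{delta,2} norm, in [0, +oo]. *)
Definition sobolev_norm (delta : R) f : \bar R :=
  ((\esum_(m in [set: d.-tuple int])
      ((1 + edot (of_intvec m) (of_intvec m)) `^ delta
       * ComplexField.Normc.normc (fourier_coef f m) ^+ 2)%:E) `^ 2^-1)%E.

(* Membership in W^{delta,2}(T^d) for delta >= 0: every distribution in that
   space is then (given by) an L^2, hence integrable, periodic function, and
   conversely an integrable function belongs to it exactly when its norm is
   finite. *)
Definition in_sobolev (delta : R) f :=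
  [/\ periodic f, torus_integrable f & (sobolev_norm delta f < +oo)%E].

(* The weighted discrepancy D_N^{Phi,a} f (x).  The sum over n in Z is
   [fsbigop]'s, meaningful because Phi N has finite support. *)
Definition discrepancy (Phi : nat -> int -> R[i]) (a : euclid R d) (N : nat) f x :
    R[i] :=
  \sum_(n \in [set: int]) Phi N n * f (eadd x (emulz a n)) - torus_integral f.

Definition sup_discrepancy (Phi : nat -> int -> R[i]) (a : euclid R d) (N : nat) f :
    \bar R :=
  ess_sup torus_measure
    (fun x => (ComplexField.Normc.normc (discrepancy Phi a N f x))%:E).

End torus.

(* ||t||, the distance from t to Z. *)
Definition dist_int (R : realType) (t : R) : R :=
  inf [set `|t - n%:~R| | n in [set: int]].

(* Main.v *)
(* A single function serves for both parts and for every alpha. With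
   [a_k = 2 ^ (- k d theta) / (k + 1)] and [P_k] the Dirichlet kernel of the cube
   [|m_i| <= 2 ^ k], put [f = \sum_k a_k P_k]. Its m-th Fourier coefficient is at most
   [C a_j], where [j] is the least index with [|m_i| <= 2 ^ j] for all [i]; hence the
   squared norm of [f] in [W^{d theta - d/2, 2}] is of order [\sum_j 1 / (j + 1) ^ 2].
   When [N] is in [A], all Fourier coefficients of [D_N f] are nonnegative, so testing
   [Re (D_N f)] against a Fejer kernel bounds the essential supremum from below by a
   constant times any finite partial sum of them. By Dirichlet's theorem the cube of
   size [2 ^ k] contains some [m <> 0] with [||m . alpha|| <= 2 ^ (- k d)], so that the
   block [a_k P_k] alone contributes at least [c N ^ (- theta) / (k + 1)] once
   [N >= 2 ^ (k d)], and the harmonic series diverges. *)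

Require Import Defs.
From HB Require Import structures.
From mathcomp Require Import all_boot all_order all_algebra.
From mathcomp Require Import all_classical all_reals all_analysis.
From mathcomp Require Import ess_sup_inf measurable_realfun.
From mathcomp Require Import ring lra zify.

Set Implicit Arguments.
Unset Strict Implicit.
Unset Printing Implicit Defensive.

Import Order.TTheory GRing.Theory Num.Theory.
Import numFieldNormedType.Exports.

Local Open Scope classical_set_scope.
Local Open Scope ring_scope.

(** * Trigonometric integrals on the torus *)

Section integration.
Local Open Scope ereal_scope.

(** The complement of [D] is null for the restricted measure, and both measures agree on subsets of
    [D]. *)
Lemma ge0_integral_mrestr dd (T : measurableType dd) (R : realType)
    (mu : {measure set T -> \bar R}) (D : set T) (mD : measurable D)
    (f : T -> \bar R) : measurable_fun setT f -> (forall x, 0 <= f x) ->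
  \int[mrestr mu mD]_x f x = \int[mu]_(x in D) f x.
Proof.
move=> mf f0.
rewrite (@ge0_negligible_integral _ _ _ _ setT (~` D))//; last 2 first.
- exact: measurableC.
- by rewrite /= /mrestr setICl measure0.
rewrite setDE setTI setCK; apply: eq_measure_integral => A mA AD.
by rewrite /= /mrestr setIidl.
Qed.

(** Tonelli's theorem: the unit cube is the product of [[0, 1)] and the unit cube of one dimension
    less. This drives the induction on [d]. *)
Lemma ge0_integral_torusS (R : realType) (d : nat)
    (f : euclid R d.+1 -> \bar R) : measurable_fun setT f ->
  (forall x, 0 <= f x) ->
  \int[torus_measure R d.+1]_x f x =
  \int[torus_measure R d]_y
    \int[@lebesgue_measure R]_(t in `[0%R, 1%R[) f (tuple_of_pair (t, y)).
Proof.
move=> mf f0.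
rewrite ge0_integral_mrestr// [LHS]ge0_integral_pushforward//; last 3 first.
- exact: measurable_tuple_of_pair.
- exact: measurable_unit_cube.
- exact: measurable_funS mf.
have mft : measurable_fun setT (f \o @tuple_of_pair R d).
  by apply: measurableT_comp => //; exact: measurable_tuple_of_pair.
have cubeE : @tuple_of_pair R d @^-1` @unit_cube R d.+1 =
    (`[0%R, 1%R[%classic : set R) `*` @unit_cube R d.
  apply/seteqP; split=> -[x t] /= h.
    split; first exact: (h ord0).
    by move=> i; have := h (lift ord0 i); rewrite tnthS.
  move=> i; case: (unliftP ord0 i) => [j|] ->; last exact: h.1.
  by rewrite tnthS; exact: h.2.
have mcube : measurable ((`[0%R, 1%R[%classic : set R) `*` @unit_cube R d).
  by apply: measurableX => //; exact: measurable_unit_cube.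
rewrite cubeE integral_mkcond.
set g := _ \_ _.
have mg : measurable_fun setT g.
  by apply/(measurable_restrictT _ mcube)/measurable_funTS.
have g0 x : 0 <= g x by rewrite /g patchE; case: ifP => // _; exact: f0.
rewrite (fubini_tonelli1 g)// (fubini_tonelli g)//.
pose h y := \int[@lebesgue_measure R]_(t in `[0%R, 1%R[) f (tuple_of_pair (t, y)).
have mh : measurable_fun setT h.
  (* Cutting off in the first coordinate only makes [h] a partial integral over all of [R], hence
     measurable. *)
  pose gs : measurableTypeR R * euclid R d -> \bar R :=
    (f \o @tuple_of_pair R d) \_ ((`[0%R, 1%R[%classic : set R) `*` setT).
  have mgs : measurable_fun setT gs.
    have mS : measurable ((`[0%R, 1%R[%classic : set (measurableTypeR R)) `*` [set: euclid R d]).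
      exact: measurableX.
    by apply/(measurable_restrictT _ mS)/measurable_funTS.
  have gs0 x : 0 <= gs x by rewrite /gs patchE; case: ifP => // _; exact: f0.
  have := measurable_fun_fubini_tonelli_G (m1 := @lebesgue_measure R) gs mgs gs0.
  apply: eq_measurable_fun => y _; rewrite /h integral_mkcond.
  by apply: eq_integral => x _; rewrite /gs !patchE in_setX in_setT andbT.
rewrite ge0_integral_mrestr//; last by move=> y; apply: integral_ge0.
rewrite [RHS]integral_mkcond; apply: eq_integral => y _.
rewrite patchE; case: ifPn => [yQ|yQ].
  rewrite [RHS]integral_mkcond; apply: eq_integral => x _.
  by rewrite /g !patchE in_setX yQ andbT.
by apply: integral0_eq => x _; rewrite /g patchE in_setX (negbTE yQ) andbF.
Qed.

End integration.

Section trigonometry.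
Context (R : realType).

Lemma cosD2piz (k : int) (x : R) : cos (x + 2 * pi * k%:~R) = cos x.
Proof.
have E n y : cos (y + 2 * pi * n%:R) = cos y :> R.
  rewrite -[RHS](periodicn (@cosD2pi R) n y).
  have -> // : 2 * pi * n%:R = pi *+ 2 *+ n :> R.
  by rewrite mulr_natr mulr_natl.
case: (intP k) => [|n|n]; first by rewrite mulr0 addr0.
  exact: (E n.+1).
by rewrite -[LHS](E n.+1) mulrNz mulrN subrK.
Qed.

Lemma sinD2piz (k : int) (x : R) : sin (x + 2 * pi * k%:~R) = sin x.
Proof. by rewrite -!cosBpihalf addrAC cosD2piz. Qed.

(** The summand [1] keeps the integrand nonnegative, so that Tonelli's theorem can be applied one
    coordinate at a time. For [k != 0] the oscillating part of the primitive is 1-periodic and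
    cancels. *)
Lemma integral_cos_unit (k : int) (c : R) :
  (\int[@lebesgue_measure R]_(t in `[0%R, 1%R[)
    (1 + cos (2 * pi * (k%:~R * t) + c))%:E = (1 + (k == 0)%:R * cos c)%:E)%E.
Proof.
have cf : continuous (fun t : R => 1 + cos (2 * pi * (k%:~R * t) + c)).
  move=> x; apply: cvgD; first exact: cvg_cst.
  apply: (continuous_cvg _ (@continuous_cos R _)).
  apply: cvgD; last exact: cvg_cst.
  by apply: cvgMl_tmp; apply: cvgMl_tmp; exact: cvg_id.
rewrite integral_itv_bndo_bndc; last first.
  apply/measurable_EFinP; apply: measurable_funTS.
  exact: continuous_measurable_fun.
have [->|k0] := eqVneq k 0.
  under eq_integral do rewrite mul0r mulr0 add0r.
  rewrite integral_cst//= lebesgue_measure_itv/= lte_fin ltr01.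
  by rewrite oppr0 adde0 mule1 mul1r.
pose F (t : R) := t + (2 * pi * k%:~R)^-1 * sin (2 * pi * (k%:~R * t) + c).
have pik : 2 * pi * k%:~R != 0 :> R.
  by rewrite !mulf_eq0 pnatr_eq0 intr_eq0 (negbTE k0) (gt_eqF (pi_gt0 R)).
have dF (x : R) : is_derive x 1 F (1 + cos (2 * pi * (k%:~R * x) + c)).
  apply: is_derive_eq.
  by rewrite /GRing.scale/= mulr1 addr0 mulrCA mulVf// mulr1.
have Fc : continuous F.
  by move=> x; apply: differentiable_continuous; apply/derivable1_diffP; case: (dF x).
rewrite (@continuous_FTC2 _ _ F)//.
- rewrite -EFinB /F !mulr0 !mulr1 [_ + c]addrC sinD2piz !add0r.
  by rewrite mul0r addr0 addrK.
- exact: continuous_subspaceT.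
- split => //=.
  + by apply: cvg_at_right_filter; exact: Fc.
  + by apply: cvg_at_left_filter; exact: Fc.
- by move=> x _; rewrite derive1E; case: (dF x).
Qed.

End trigonometry.

Section waves.
Context (R : realType) (d : nat).
Local Notation mu := (torus_measure R d).

(** Frequencies are finite functions for the sake of the pointwise group operations [v - w] and
    [- v]; [tuple_freq] links them to integer tuples. *)
Definition phase (v : {ffun 'I_d -> int}) (x : euclid R d) : R :=
  \sum_(i < d) (v i)%:~R * (tnth x i : R).

Lemma phaseD v x a : phase v (eadd x a) = phase v x + phase v a.
Proof.
by rewrite /phase -big_split/=; apply: eq_bigr => i _; rewrite tnth_mktuple mulrDr.
Qed.

Lemma phase_emulz v a n : phase v (emulz a n) = n%:~R * phase v a.
Proof.
rewrite /phase mulr_sumr; apply: eq_bigr => i _.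
by rewrite tnth_mktuple mulrzAr [RHS]mulrzl.
Qed.

Lemma phase_intvec v m : phase v (of_intvec R m) = (\sum_(i < d) v i * tnth m i)%:~R.
Proof.
rewrite /phase rmorph_sum/=; apply: eq_bigr => i _.
by rewrite tnth_mktuple rmorphM.
Qed.

Lemma edot_phase m x : edot (of_intvec R m) x = phase [ffun i => tnth m i] x.
Proof.
by rewrite /edot /phase; apply: eq_bigr => i _; rewrite tnth_mktuple ffunE.
Qed.

Lemma phase_opp v x : phase (- v) x = - phase v x.
Proof.
rewrite /phase -sumrN; apply: eq_bigr => i _.
by rewrite ffunE rmorphN mulNr.
Qed.

Lemma phase_add v w x : phase (v + w) x = phase v x + phase w x.
Proof.
rewrite /phase -big_split; apply: eq_bigr => i _.
by rewrite ffunE rmorphD mulrDl.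
Qed.

Lemma phase0 x : phase 0 x = 0.
Proof. by apply: big1 => i _; rewrite ffunE mul0r. Qed.

Lemma measurable_phase v : measurable_fun setT (phase v).
Proof.
apply: measurable_sum => i; apply: measurable_funM; first exact: measurable_cst.
exact: measurable_tnth.
Qed.

(** The shift [c] lets one real family contain the cosines, the sines (up to sign, at [c = pi / 2])
    and all their translates. *)
Definition wave v (c : R) (x : euclid R d) : R := cos (2 * pi * phase v x + c).

Lemma measurable_wave v c : measurable_fun setT (wave v c).
Proof.
apply: measurableT_comp; first exact: continuous_measurable_fun (@continuous_cos R).
apply: measurable_funD; last exact: measurable_cst.
by apply: measurable_funM; [exact: measurable_cst|exact: measurable_phase].
Qed.

Lemma wave_bound v c x : `|wave v c x| <= 1.
Proof. exact: cos_max. Qed.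

Lemma wave_shift v c x a : wave v c (eadd x a) = wave v (2 * pi * phase v a + c) x.
Proof. by rewrite /wave phaseD mulrDr addrA. Qed.

Lemma torus_measureT : mu setT = 1%E.
Proof.
rewrite /= /mrestr setTI.
rewrite (lebesgue_euclid_box (B := fun=> `[0, 1[%classic))//.
apply: big1 => i _; rewrite /= lebesgue_measure_itv/= lte_fin ltr01.
by rewrite oppr0 adde0.
Qed.

Lemma bounded_integrable (f : euclid R d -> R) (B : R) :
  measurable_fun setT f -> (forall x, `|f x| <= B) ->
  mu.-integrable setT (EFin \o f).
Proof.
move=> mf fB; apply: measurable_bounded_integrable => //.
  by rewrite [X in (X < _)%E]torus_measureT ltry.
exists B; split; first exact: num_real.
by move=> M BM x _; apply: le_trans (fB x) (ltW BM).
Qed.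

Lemma wave_integrable v c : mu.-integrable setT (EFin \o wave v c).
Proof.
exact: bounded_integrable (measurable_wave v c) (wave_bound v c).
Qed.

End waves.

Section wave_integral.
Context (R : realType).

(** Induction on [d], integrating out the first coordinate: if [v ord0 = 0] a wave in the remaining
    coordinates is left, otherwise only the constant [1] survives. *)
Lemma integral_1Dwave (d : nat) v (c : R) :
  (\int[torus_measure R d]_x (1 + wave v c x)%:E = (1 + (v == 0)%:R * cos c)%:E)%E.
Proof.
elim: d v c => [|d IH] v c.
  rewrite ge0_integral_mrestr; last 2 first.
  - apply/measurable_EFinP; apply: measurable_funD; first exact: measurable_cst.
    exact: measurable_wave.
  - by move=> x; rewrite lee_fin -lerBlDl sub0r cos_geN1.
  rewrite integral_dirac; last 2 first.
  - exact: measurable_unit_cube.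
  - apply/measurable_EFinP; apply: measurable_funTS.
    apply: measurable_funD; first exact: measurable_cst.
    exact: measurable_wave.
  rewrite /wave /phase big_ord0 mulr0 add0r.
  have -> : v == 0 by apply/eqP/ffunP => -[].
  by rewrite diracE mem_set ?mul1e ?mul1r// => -[].
have w0 u : (0 <= (1 + cos u : R)%:E)%E.
  by rewrite lee_fin -lerBlDl sub0r cos_geN1.
rewrite ge0_integral_torusS; last 2 first.
- by apply/measurable_EFinP/measurable_funD => //; exact: measurable_wave.
- by move=> x; exact: w0.
pose v' : {ffun 'I_d -> int} := [ffun i => v (lift ord0 i)].
have wE t y : wave v c (tuple_of_pair (t, y)) =
    cos (2 * pi * ((v ord0)%:~R * t) + (2 * pi * phase v' y + c)).
  rewrite /wave /phase big_ord_recl/= addrA -mulrDr.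
  congr (cos (_ * _ + _)); congr (_ + _); apply: eq_bigr => i _.
  by rewrite ffunE tnthS.
under eq_integral do under eq_integral do rewrite wE.
under eq_integral do rewrite integral_cos_unit.
have -> : (v == 0) = (v ord0 == 0) && (v' == 0).
  apply/eqP/andP => [v0|[/eqP v0 /eqP v'0]].
    by split; [|apply/eqP/ffunP => i]; rewrite /v' v0 !ffunE.
  apply/ffunP => i; rewrite ffunE; case: (unliftP ord0 i) => [j|] -> //.
  by move/ffunP: v'0 => /(_ j); rewrite !ffunE.
case: eqP => [_|_] /=.
  under eq_integral do rewrite mul1r.
  exact: IH.
under eq_integral do rewrite mul0r addr0.
by rewrite integral_cst// mul1e [X in X = _]torus_measureT mul0r addr0.
Qed.

Lemma integral_wave (d : nat) v (c : R) :
  \int[torus_measure R d]_x wave v c x = (v == 0)%:R * cos c.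
Proof.
have /(congr1 fine)/= := integral_1Dwave v c.
rewrite -/(Rintegral _ _ _) RintegralD//; last 2 first.
- apply: (@bounded_integrable _ _ (fun=> 1) 1); first exact: measurable_cst.
  by move=> x; rewrite normr1.
- exact: wave_integrable.
by rewrite Rintegral_cst// torus_measureT mul1r => /addrI.
Qed.

End wave_integral.

(** * Series converging in mean *)

Section sum_of_series.
Context dd (T : measurableType dd) (R : realType).
Variable mu : {measure set T -> \bar R}.

Lemma Rintegral_sum (I : Type) (s : seq I) (f : I -> T -> R) :
  (forall i, mu.-integrable setT (EFin \o f i)) ->
  \int[mu]_x (\sum_(i <- s) f i x) = \sum_(i <- s) \int[mu]_x f i x.
Proof.
move=> intf; rewrite /Rintegral; under eq_integral do rewrite -sumEFin.
rewrite integral_sum// -sum_fine// => i _.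
by apply: integrable_fin_num => //; exact: intf.
Qed.

Variable G : nat -> T -> R.
Hypothesis mG : forall k, measurable_fun setT (G k).

(* Agrees with the sum of the series wherever it converges. *)
Definition fsum (x : T) : R := fine (limn_esup (fun n => (series (G ^~ x) n)%:E)).

Lemma measurable_partial n : measurable_fun setT (fun x => series (G ^~ x) n).
Proof. exact: measurable_sum. Qed.

Lemma measurable_fsum : measurable_fun setT fsum.
Proof.
apply: measurableT_comp; first exact: fine_measurable.
apply: measurable_fun_limn_esup => n.
by apply/measurable_EFinP; exact: measurable_partial.
Qed.

Lemma cvg_fsum x : cvgn (series (G ^~ x)) -> series (G ^~ x) @ \oo --> fsum x.
Proof.
move=> cG; suff -> : fsum x = limn (series (G ^~ x)) by [].
have cGE : (fun n => (series (G ^~ x) n)%:E) @ \oo --> (limn (series (G ^~ x)))%:E.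
  by apply: cvg_EFin => //; apply: nearW.
by rewrite /fsum is_cvg_limn_esupE; [rewrite (cvg_lim _ cGE)|exact: cvgP cGE].
Qed.

Variable M : R.
Hypothesis GM : forall n, (\sum_(0 <= k < n) \int[mu]_x `|G k x|%:E <= M%:E)%E.

(** The majorant for dominated convergence. By [GM] and monotone convergence it is integrable, hence
    finite almost everywhere, and where it is finite the series converges absolutely. *)
Let D x : \bar R := (\sum_(0 <= k <oo) `|G k x|%:E)%E.

Let mD : measurable_fun setT D.
Proof.
apply: ge0_emeasurable_sum => // k _.
by apply/measurable_EFinP; exact: measurableT_comp.
Qed.

Let D0 x : (0 <= D x)%E.
Proof. by apply: nneseries_ge0 => *; rewrite lee_fin. Qed.

Let D_integrable : mu.-integrable setT D.
Proof.
apply/integrableP; split=> //; under eq_integral do rewrite gee0_abs//.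
rewrite integral_nneseries//; last first.
  by move=> n; apply/measurable_EFinP; exact: measurableT_comp.
apply: le_lt_trans (ltry M); apply: lime_le.
  by apply: is_cvg_nneseries => n _ _; apply: integral_ge0.
by apply: nearW => n; exact: GM.
Qed.

Let D_ub x n : (`|series (G ^~ x) n|%:E <= D x)%E.
Proof.
apply: (@le_trans _ _ (\sum_(0 <= k < n) `|G k x|%:E)%E).
  by rewrite sumEFin lee_fin; exact: ler_norm_sum.
exact: nneseries_lim_ge.
Qed.

Let D_cvg x : D x \is a fin_num -> cvgn (series (G ^~ x)).
Proof.
move=> Dx; apply: normed_cvg; apply: nondecreasing_is_cvgn.
  by apply: nondecreasing_series => n _ _; exact: normr_ge0.
exists (fine (D x)) => _ [n _ <-].
by rewrite -lee_fin fineK// /series/= -sumEFin; exact: nneseries_lim_ge.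
Qed.

Let dominated (h : T -> R) (B : R) : measurable_fun setT h ->
  (forall x, `|h x| <= B) ->
  mu.-integrable setT (EFin \o (fun x => fsum x * h x)) /\
  (fun n => \int[mu]_x (series (G ^~ x) n * h x)%:E)%E @ \oo -->
    (\int[mu]_x (fsum x * h x)%:E)%E.
Proof.
move=> mh hB.
have B0 : 0 <= B by exact: le_trans (normr_ge0 (h point)) (hB point).
have [//|//|//|//|//|] := @dominated_convergence _ _ _ mu setT measurableT
  (fun n x => (series (G ^~ x) n * h x)%:E) (fun x => (fsum x * h x)%:E)
  (fun x => B%:E * D x)%E.
- move=> n; apply/measurable_EFinP; apply: measurable_funM => //.
  exact: measurable_partial.
- apply/measurable_EFinP; apply: measurable_funM => //.
  exact: measurable_fsum.
- have := integrable_ae measurableT D_integrable.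
  apply: filterS => x /(_ Logic.I) /D_cvg /cvg_fsum Gx _.
  apply: cvg_EFin; first by apply: nearW.
  by apply: cvgM => //; exact: cvg_cst.
- exact: integrableZl.
- apply: aeW => x n _; rewrite abse_EFin normrM mulrC EFinM lee_pmul//.
  by rewrite lee_fin.
by move=> ? _ ?.
Qed.

Lemma integrable_fsumM (h : T -> R) (B : R) : measurable_fun setT h ->
  (forall x, `|h x| <= B) ->
  mu.-integrable setT (EFin \o (fun x => fsum x * h x)).
Proof. by move=> mh hB; case: (dominated mh hB). Qed.

Lemma cvg_integral_fsum (h : T -> R) (B : R) : measurable_fun setT h ->
  (forall x, `|h x| <= B) ->
  (forall k, mu.-integrable setT (EFin \o G k)) ->
  series (fun k => \int[mu]_x (G k x * h x)) @ \oo --> \int[mu]_x (fsum x * h x).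
Proof.
move=> mh hB Gi; have [Si cS] := dominated mh hB.
have Ghi k : mu.-integrable setT (EFin \o (fun x => G k x * h x)).
  have -> : EFin \o (fun x => G k x * h x) = ((EFin \o G k) \* (EFin \o h))%E.
    by apply/funext => x /=; rewrite EFinM.
  apply: integrableMl => //; exists B; split; first exact: num_real.
  by move=> C BC x _; apply: le_trans (hB x) (ltW BC).
have -> : series (fun k => \int[mu]_x (G k x * h x)) =
    fine \o (fun n => \int[mu]_x (series (G ^~ x) n * h x)%:E)%E.
  apply/funext => n; rewrite /series/= -Rintegral_sum//.
  by congr fine; apply: eq_integral => x _; rewrite mulr_suml.
apply: fine_cvg; rewrite /Rintegral fineK//.
exact: integrable_fin_num.
Qed.

End sum_of_series.

(** * Orthogonality and mean size of trigonometric sums *)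

Section trigonometric_sums.
Context (R : realType) (d : nat).
Local Notation mu := (torus_measure R d).
Local Notation freq := {ffun 'I_d -> int}.
Implicit Types (v w : freq) (x : euclid R d).

Lemma waveM v c w e x : wave v c x * wave w e x =
  2^-1 * (wave (v - w) (c - e) x + wave (v + w) (c + e) x).
Proof.
have prodE (a b : R) : cos a * cos b = 2^-1 * (cos (a - b) + cos (a + b)).
  by rewrite cosB cosD; field.
rewrite /wave prodE !phase_add phase_opp.
by congr (_ * (cos _ + cos _)); ring.
Qed.

Lemma waveM_integrable v c w e :
  mu.-integrable setT (EFin \o (fun x => wave v c x * wave w e x)).
Proof.
apply: (@bounded_integrable _ _ _ 1).
  by apply: measurable_funM; exact: measurable_wave.
by move=> x; rewrite normrM mulr_ile1// wave_bound.
Qed.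

(** Two resonances occur because a real wave of frequency [w] is also one of frequency [- w]. *)
Lemma integral_waveM v c w e : \int[mu]_x (wave v c x * wave w e x) =
  2^-1 * ((v == w)%:R * cos (c - e) + (v == - w)%:R * cos (c + e)).
Proof.
under eq_Rintegral do rewrite waveM.
rewrite RintegralZl//; last first.
  apply: (@bounded_integrable _ _ _ 2).
    by apply: measurable_funD; exact: measurable_wave.
  by move=> x; rewrite (le_trans (ler_normD _ _))// (_ : 2 = 1 + 1)// lerD ?wave_bound.
rewrite RintegralD//; [|exact: wave_integrable..].
by rewrite !integral_wave subr_eq0 addr_eq0.
Qed.

(** Each frequency has its own shift, so that translates are sums of the same form. *)
Definition tsum (s : seq freq) (c : freq -> R) x : R := \sum_(v <- s) wave v (c v) x.

Lemma measurable_tsum s c : measurable_fun setT (tsum s c).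
Proof. by apply: measurable_sum => v; exact: measurable_wave. Qed.

Lemma tsum_bound s c x : `|tsum s c x| <= (size s)%:R.
Proof.
rewrite (le_trans (ler_norm_sum _ _ _))// -sum1_size natr_sum ler_sum// => v _.
exact: wave_bound.
Qed.

(** By orthogonality [v] interacts only with [v] and [- v], each time with a factor [1 / 2] and a
    cosine at most 1; so each frequency contributes at most 1. *)
Lemma integral_tsum_sqr s c : uniq s ->
  \int[mu]_x (tsum s c x ^+ 2) <= (size s)%:R.
Proof.
move=> us; have E x : tsum s c x ^+ 2 =
    \sum_(v <- s) \sum_(w <- s) wave v (c v) x * wave w (c w) x.
  by rewrite expr2 /tsum mulr_suml; apply: eq_bigr => v _; rewrite mulr_sumr.
under eq_Rintegral do rewrite E.
have wwi v w : mu.-integrable setT (EFin \o (fun x => wave v (c v) x * wave w (c w) x)).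
  exact: waveM_integrable.
rewrite Rintegral_sum; last first.
  move=> v; have -> : EFin \o (fun x => \sum_(w <- s) wave v (c v) x * wave w (c w) x) =
      (fun x => \sum_(w <- s) (wave v (c v) x * wave w (c w) x)%:E)%E.
    by apply/funext => x /=; rewrite sumEFin.
  by apply: integrable_sum => // w _; exact: wwi.
rewrite -sum1_size natr_sum; apply: ler_sum => v _.
rewrite Rintegral_sum; last by move=> w; exact: wwi.
have le1 u (y : freq -> R) : (forall w, y w <= 1) -> \sum_(w <- s) (u == w)%:R * y w <= 1.
  move=> y1; have [us'|us'] := boolP (u \in s); last first.
    rewrite big_seq big1 ?ler01// => w ws; case: eqP => [uw|_]; last by rewrite mul0r.
    by rewrite uw ws in us'.
  rewrite (bigD1_seq u)//= eqxx mul1r big1 ?addr0// => w /negbTE.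
  by rewrite eq_sym => ->; rewrite mul0r.
rewrite (eq_bigr (fun w => 2^-1 * ((v == w)%:R * cos (c v - c w)) +
    2^-1 * ((- v == w)%:R * cos (c v + c w)))); last first.
  by move=> w _; rewrite integral_waveM mulrDr eqr_oppLR.
rewrite big_split/= -!mulr_sumr.
have A := le1 v (fun w => cos (c v - c w)) (fun=> cos_le1 _).
have B := le1 (- v) (fun w => cos (c v + c w)) (fun=> cos_le1 _).
by move: A B => /=; lra.
Qed.

(** Cauchy-Schwarz on a space of mass 1. The square root, instead of the trivial bound [size s], is
    what lets the series of the extremal function converge in mean for every [theta > 1 / 2]. *)
Lemma integral_abs_tsum s c : uniq s -> (0 < size s)%N ->
  (\int[mu]_x `|tsum s c x|%:E <= (Num.sqrt (size s)%:R)%:E)%E.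
Proof.
move=> us s0; set q := Num.sqrt _.
have q0 : 0 < q by rewrite sqrtr_gt0 ltr0n.
have qq : q ^+ 2 = (size s)%:R by rewrite sqr_sqrtr.
have sqi : mu.-integrable setT (EFin \o (fun x => tsum s c x ^+ 2)).
  apply: (@bounded_integrable _ _ _ ((size s)%:R ^+ 2)).
    by apply: measurable_funX; exact: measurable_tsum.
  by move=> x; rewrite normrX lerXn2r ?nnegrE// tsum_bound.
have absi : mu.-integrable setT (EFin \o (fun x => `|tsum s c x|)).
  apply: (@bounded_integrable _ _ _ (size s)%:R).
    by apply: measurableT_comp => //; exact: measurable_tsum.
  by move=> x; rewrite normr_id tsum_bound.
have ci : mu.-integrable setT (EFin \o (fun=> q)).
  by apply: (@bounded_integrable _ _ _ `|q|).
rewrite -[leLHS]fineK; last exact: integrable_fin_num.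
rewrite lee_fin -/(Rintegral _ _ _).
(* AM-GM: |u| <= (q + u ^ 2 / q) / 2 *)
have amgm x : `|tsum s c x| <= 2^-1 * q + (2 * q)^-1 * tsum s c x ^+ 2.
  rewrite -(ler_pM2l q0) mulrDr.
  have -> : q * (2^-1 * q) = 2^-1 * q ^+ 2 by ring.
  have -> : q * ((2 * q)^-1 * tsum s c x ^+ 2) = 2^-1 * `|tsum s c x| ^+ 2.
    by rewrite real_normK ?num_real//; field; rewrite gt_eqF.
  by have := sqr_ge0 (q - `|tsum s c x|); nra.
have i1 : mu.-integrable setT (EFin \o (fun=> 2^-1 * q)).
  by apply: (@bounded_integrable _ _ _ `|2^-1 * q|).
have i2 : mu.-integrable setT (EFin \o (fun x => (2 * q)^-1 * tsum s c x ^+ 2)).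
  have := @integrableZl _ _ _ mu _ measurableT (2 * q)^-1 _ sqi.
  by apply: eq_integrable => // x _.
apply: le_trans (le_Rintegral measurableT absi _ (fun x _ => amgm x)) _.
  have := @integrableD _ _ _ mu _ measurableT _ _ i1 i2.
  by apply: eq_integrable => // x _.
rewrite RintegralD// [X in _ + X]RintegralZl// Rintegral_cst// torus_measureT mulr1.
have := integral_tsum_sqr c us; rewrite -qq => H.
have qE : q = 2^-1 * q + (2 * q)^-1 * q ^+ 2 by field; rewrite gt_eqF.
rewrite [leRHS]qE.
by rewrite lerD2l ler_wpM2l// invr_ge0 mulr_ge0// ltW.
Qed.

End trigonometric_sums.

(** * Dirichlet's theorem and the Fejer kernel *)

Section distance_to_integers.
Context (R : realType).
Implicit Type t : R.

Lemma dist_int_le t (n : int) : dist_int t <= `|t - n%:~R|.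
Proof.
apply: ge_inf; last by exists n.
by exists 0 => _ [k _ <-].
Qed.

Lemma dist_int_ge0 t : 0 <= dist_int t.
Proof.
by apply: lb_le_inf; [exists `|t - 0%:~R|, 0 => //|move=> _ [k _ <-]].
Qed.

Lemma dist_intN t : dist_int (- t) = dist_int t.
Proof.
congr inf; apply/seteqP; split=> _ [k _ <-]; exists (- k) => //.
- by rewrite -normrN rmorphN; congr (`| _ |); ring.
- by rewrite -normrN rmorphN; congr (`| _ |); ring.
Qed.

End distance_to_integers.

Section frequencies.
Context (d : nat).
Local Notation freq := {ffun 'I_d -> int}.
Implicit Types (v : freq).

Definition cube (n : nat) : seq freq :=
  [seq [ffun i => (c i : nat)%:Z - n%:Z] | c : {ffun 'I_d -> 'I_(n.*2.+1)}].

Lemma mem_cube n v : (v \in cube n) = [forall i, (`|v i| <= n)%N].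
Proof.
apply/mapP/forallP => [[c _ ->] i|vn].
  by rewrite ffunE; have := ltn_ord (c i); move: (nat_of_ord _) => k; lia.
exists [ffun i => inord (absz (v i + n%:Z)%R)]; first by rewrite mem_enum.
apply/ffunP => i; rewrite !ffunE inordK; move: (vn i); move: (v i) => u; lia.
Qed.

Lemma cube_uniq n : uniq (cube n).
Proof.
rewrite map_inj_uniq ?enum_uniq// => b c /ffunP bc.
apply/ffunP => i; apply: val_inj => /=.
by have := bc i; rewrite !ffunE; move: (nat_of_ord _) (nat_of_ord _) => k l; lia.
Qed.

Lemma size_cube n : size (cube n) = (n.*2.+1 ^ d)%N.
Proof. by rewrite size_map -cardE card_ffun !card_ord. Qed.

Definition natfreq n (b : {ffun 'I_d -> 'I_n}) : freq := [ffun i => (b i : nat)%:Z].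

Lemma natfreq_inj n : injective (@natfreq n).
Proof.
move=> b c /ffunP bc; apply/ffunP => i; apply: val_inj => /=.
by have := bc i; rewrite !ffunE; move: (nat_of_ord _) (nat_of_ord _) => k l; lia.
Qed.

(* Dirichlet: two of the [(q+1)^d] values [b . a] mod 1 lie in the same one of
   [q^d] equal subintervals of [0, 1). *)
Lemma dirichlet (R : realType) (q : nat) (a : euclid R d) : (0 < d)%N -> (0 < q)%N ->
  exists v, [/\ v \in cube q, v != 0 & dist_int (phase v a) <= (q%:R ^+ d)^-1].
Proof.
move=> d0 q0; pose fr (t : R) := t - (Num.floor t)%:~R.
have fr0 t : 0 <= fr t by rewrite subr_ge0 floor_le.
have fr1 t : fr t < 1 by rewrite ltrBlDl -intrD1 floorD1_gt.
have Q0 : 0 < (q ^ d)%:R :> R by rewrite ltr0n expn_gt0 q0.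
(* [inord] needs a successor as bound; [.-1.+1] changes nothing because [q ^ d] is positive. *)
pose f (b : {ffun 'I_d -> 'I_q.+1}) : 'I_(q ^ d).-1.+1 :=
  inord (Num.truncn ((q ^ d)%:R * fr (phase (natfreq b) a))).
have /injectivePn[b [c bc fbc]] : ~~ injectiveb f.
  apply/injectiveP => /leq_card; rewrite card_ffun !card_ord prednK ?expn_gt0 ?q0//.
  by rewrite leqNgt ltn_exp2r// ltnSn.
exists (natfreq b - natfreq c); split.
- by rewrite mem_cube; apply/forallP => i; rewrite !ffunE;
    have := ltn_ord (b i); have := ltn_ord (c i);
    move: (nat_of_ord _) (nat_of_ord _) => k l; lia.
- by rewrite subr_eq0 (inj_eq (@natfreq_inj _)).
set s := phase (natfreq b) a; set t := phase (natfreq c) a.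
have -> : phase (natfreq b - natfreq c) a = s - t by rewrite phase_add phase_opp.
apply: le_trans (dist_int_le _ (Num.floor s - Num.floor t)) _.
have -> : s - t - (Num.floor s - Num.floor t)%:~R = fr s - fr t.
  by rewrite /fr rmorphB/=; ring.
have trunc u : (Num.truncn ((q ^ d)%:R * fr u) < (q ^ d).-1.+1)%N.
  rewrite prednK ?expn_gt0 ?q0// truncn_lt_nat ?mulr_ge0// ?ltW//.
  by rewrite gtr_pMr// fr1.
have := congr1 (@nat_of_ord _) fbc; rewrite /f !inordK ?trunc// -/s -/t => st.
have /andP[s1 s2] := truncn_itv (mulr_ge0 (ltW Q0) (fr0 s)).
have /andP[t1 t2] := truncn_itv (mulr_ge0 (ltW Q0) (fr0 t)).
rewrite st in s1 s2.
rewrite -natrX -(ler_pM2l Q0) mulfV ?gt_eqF// -[X in X * _]gtr0_norm// -normrM.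
move: s1 s2 t1 t2; rewrite -!natr1 => s1 s2 t1 t2.
by rewrite ler_norml; apply/andP; split; lra.
Qed.

End frequencies.

Section fejer_kernel.
Context (R : realType) (d : nat).
Local Notation mu := (torus_measure R d).
Local Notation box L := {ffun 'I_d -> 'I_L}.

(** The product Fejer kernel: the squared modulus of the exponential sum over the box
    [{0, ..., L - 1} ^ d], expanded into waves and divided by [L ^ d]. *)
Definition fejer (L : nat) (x : euclid R d) : R :=
  (L ^ d)%:R^-1 * \sum_(p : box L * box L) wave (natfreq p.1 - natfreq p.2) 0 x.

(** This is the product over [i] of [max 0 (1 - |v i| / L)], written as a count of pairs of box
    points with difference [v]. *)
Definition fejer_coef (L : nat) (v : {ffun 'I_d -> int}) : R :=
  (L ^ d)%:R^-1 * \sum_(p : box L * box L) (v == natfreq p.1 - natfreq p.2)%:R.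

Lemma measurable_fejer L : measurable_fun setT (fejer L).
Proof.
apply: measurable_funM; first exact: measurable_cst.
by apply: measurable_sum => p; exact: measurable_wave.
Qed.

Lemma fejer_bound L x : `|fejer L x| <= (L ^ d)%:R^-1 * #|{: box L * box L}|%:R.
Proof.
rewrite normrM ger0_norm ?invr_ge0// ler_wpM2l ?invr_ge0//.
rewrite (le_trans (ler_norm_sum _ _ _))// -sum1_card natr_sum ler_sum// => p _.
exact: wave_bound.
Qed.

Lemma fejer_ge0 L x : 0 <= fejer L x.
Proof.
rewrite mulr_ge0 ?invr_ge0//.
pose th (b : box L) := 2 * pi * phase (natfreq b) x.
have -> : \sum_(p : box L * box L) wave (natfreq p.1 - natfreq p.2) 0 x =
    (\sum_b cos (th b)) ^+ 2 + (\sum_b sin (th b)) ^+ 2.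
  rewrite !expr2 !mulr_suml -big_split/=.
  rewrite -(pair_bigA _ (fun b b' => wave (natfreq b - natfreq b') 0 x))/=.
  apply: eq_bigr => b _; rewrite !mulr_sumr -big_split/=; apply: eq_bigr => b' _.
  by rewrite /wave addr0 phase_add phase_opp mulrBr cosB.
by rewrite addr_ge0 ?sqr_ge0.
Qed.

Lemma fejer_coef_ge0 L v : 0 <= fejer_coef L v.
Proof. by rewrite mulr_ge0 ?invr_ge0// sumr_ge0. Qed.

Lemma fejer_coef0 L : (0 < L)%N -> fejer_coef L 0 = 1.
Proof.
move=> L0; rewrite /fejer_coef.
have -> : \sum_(p : box L * box L) (0 == natfreq p.1 - natfreq p.2)%:R = (L ^ d)%:R :> R.
  rewrite -(pair_bigA _ (fun b b' : box L => (0 == natfreq b - natfreq b')%:R))/=.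
  rewrite -[in RHS](card_ord L) -[in RHS](card_ord d) -card_ffun -sum1_card natr_sum.
  apply: eq_bigr => b _; rewrite (bigD1 b)//= subrr eqxx big1 ?addr0// => b' /negbTE b'b.
  by rewrite eq_sym subr_eq0 (inj_eq (@natfreq_inj _ _)) eq_sym b'b.
by rewrite mulVf// pnatr_eq0 expn_eq0 gtn_eqF.
Qed.

(** Split [v = p - q] into positive and negative parts. Every [c] in the box of side [n] yields the
    pair [(c + p, c + q)] in the box of side [2 n], which gives [n ^ d] pairs, to be divided by
    [(2 n) ^ d]. *)
Lemma fejer_coef_cube n v : (0 < n)%N -> v \in cube d n ->
  (2 ^ d)%:R^-1 <= fejer_coef n.*2 v.
Proof.
rewrite mem_cube => n0 /forallP vn.
have [p [q [pn qn vE]]] : exists p q : 'I_d -> nat,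
    [/\ forall i, (p i <= n)%N, forall i, (q i <= n)%N &
        forall i, v i = (p i)%:Z - (q i)%:Z].
  exists (fun i => if 0 <= v i then absz (v i) else 0%N).
  exists (fun i => if 0 <= v i then 0%N else absz (v i)).
  by split=> i; move: (vn i); move: (v i) => u; case: ifP; lia.
have lt_double (c : 'I_n) k : (k <= n)%N -> (c + k < n.*2)%N.
  by rewrite -addnn => kn; rewrite -addSn leq_add// ltn_ord.
pose g (c : box n) : box n.*2 * box n.*2 :=
  ([ffun i => Ordinal (lt_double (c i) _ (pn i))],
   [ffun i => Ordinal (lt_double (c i) _ (qn i))]).
have g_inj : injective g.
  move=> b c [/ffunP bc _]; apply/ffunP => i; apply: val_inj => /=.
  by have := bc i; rewrite !ffunE => /(congr1 (@nat_of_ord _))/= /addIn.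
rewrite /fejer_coef ler_pdivlMl ?ltr0n ?expn_gt0 ?double_gt0 ?n0//.
have -> : (n.*2 ^ d)%:R / (2 ^ d)%:R = #|[set: box n]%SET|%:R :> R.
  rewrite cardsT card_ffun !card_ord -muln2 expnMn natrM mulfK//.
rewrite -(card_imset _ g_inj) -sum1_card natr_sum.
rewrite [leRHS](bigID (mem (g @: [set: box n]%SET)))/= -[leLHS]addr0 lerD ?sumr_ge0//.
apply: ler_sum => _ /imsetP[c _ ->] /=.
rewrite (_ : v == _) //; apply/eqP/ffunP => i; rewrite !ffunE /= vE.
by rewrite !PoszD; ring.
Qed.

Lemma integral_wave_fejer L v c :
  \int[mu]_x (wave v c x * fejer L x) = fejer_coef L v * cos c.
Proof.
under eq_Rintegral do rewrite mulrCA mulr_sumr.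
have ii (p : box L * box L) := waveM_integrable v c (natfreq p.1 - natfreq p.2) 0.
rewrite RintegralZl//; last first.
  have -> : EFin \o (fun x => \sum_(p : box L * box L)
        wave v c x * wave (natfreq p.1 - natfreq p.2) 0 x) =
      (fun x => \sum_(p : box L * box L) (wave v c x * wave (natfreq p.1 - natfreq p.2) 0 x)%:E)%E.
    by apply/funext => x /=; rewrite sumEFin.
  by apply: integrable_sum => // p _; exact: ii.
rewrite Rintegral_sum; last exact: ii.
rewrite /fejer_coef -mulrA; congr (_ * _).
rewrite (eq_bigr (fun p : box L * box L =>
    2^-1 * cos c * (v == natfreq p.1 - natfreq p.2)%:R +
    2^-1 * cos c * (v == natfreq p.2 - natfreq p.1)%:R)); last first.
  by move=> p _; rewrite integral_waveM subr0 addr0 opprB; ring.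
rewrite big_split/= -!mulr_sumr.
(* The kernel is even: swapping the two box points identifies the counts for [v] and [- v]. *)
rewrite [X in _ + _ * X](reindex_inj (h := fun p => (p.2, p.1)))/=; last first.
  by move=> [? ?] [? ?] [-> ->].
by field.
Qed.

Lemma integral_fejer L : (0 < L)%N -> \int[mu]_x fejer L x = 1.
Proof.
move=> L0; rewrite -(fejer_coef0 L0) -[RHS]mulr1 -cos0 -integral_wave_fejer.
by apply: eq_Rintegral => x _; rewrite /wave phase0 mulr0 addr0 cos0 mul1r.
Qed.

End fejer_kernel.

(** * The extremal function and its Sobolev norm *)

Section shells.
Context (d : nat).
Local Notation freq := {ffun 'I_d -> int}.
Implicit Type v : freq.

(** A full cube rather than a difference of cubes: the shells are nested, and a frequency in one of
    them lies in all later ones. *)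
Definition shell (k : nat) : seq freq := cube d (2 ^ k).

Lemma size_shell (R : realType) k : ((size (shell k))%:R <= 3 ^+ d * (2 ^+ d) ^+ k :> R).
Proof.
rewrite size_cube -exprM mulnC exprM -exprMn natrX lerXn2r ?nnegrE ?mulr_ge0 ?exprn_ge0//.
by rewrite -natrX -natrM ler_nat; have := expn_gt0 2 k; lia.
Qed.

Lemma shell_mono k l : (k <= l)%N -> {subset shell k <= shell l}.
Proof.
move=> kl v; rewrite !mem_cube => /forallP vk; apply/forallP => i.
by rewrite (leq_trans (vk i))// leq_exp2l.
Qed.

Lemma mem_shellN k v : (- v \in shell k) = (v \in shell k).
Proof. by rewrite !mem_cube; apply: eq_forallb => i; rewrite ffunE abszN. Qed.

Lemma mem_shell0 k : 0 \in shell k.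
Proof. by rewrite mem_cube; apply/forallP => i; rewrite ffunE. Qed.

End shells.

Section extremal_function.
Context (R : realType) (d : nat) (lam : R).
Local Notation mu := (torus_measure R d).
Local Notation freq := {ffun 'I_d -> int}.
Hypothesis lam_gt0 : 0 < lam.
Hypothesis lam_small : lam * Num.sqrt (2 ^+ d) < 1.
Implicit Types (v w : freq) (x a : euclid R d) (c : freq -> R).

Definition amp (k : nat) : R := lam ^+ k / k.+1%:R.

Lemma amp_ge0 k : 0 <= amp k.
Proof. by rewrite divr_ge0 ?exprn_ge0// ltW. Qed.

Lemma lam_lt1 : lam < 1.
Proof.
apply: le_lt_trans lam_small; rewrite -[leLHS]mulr1 ler_wpM2l ?(ltW lam_gt0)//.
by rewrite -[leLHS]sqrtr1 ler_wsqrtr// exprn_ege1// ler1n.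
Qed.

Definition term c (k : nat) x : R := amp k * tsum (shell d k) c x.

Lemma measurable_term c k : measurable_fun setT (term c k).
Proof.
by apply: measurable_funM; [exact: measurable_cst|exact: measurable_tsum].
Qed.

Lemma term_integrable c k : mu.-integrable setT (EFin \o term c k).
Proof.
apply: (@bounded_integrable _ _ _ (amp k * (size (shell d k))%:R)).
  exact: measurable_term.
by move=> x; rewrite normrM ger0_norm ?amp_ge0// ler_wpM2l ?amp_ge0// tsum_bound.
Qed.

(** The mean of the absolute value of term [k] is at most [amp k] times the square root of the shell
    size, hence bounded by a geometric sequence whose ratio is below 1 by [lam_small]. *)
Lemma term_summable c : exists M : R, forall n,
  (\sum_(0 <= k < n) \int[mu]_x `|term c k x|%:E <= M%:E)%E.
Proof.
pose r := lam * Num.sqrt (2 ^+ d).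
have r0 : 0 < r by rewrite mulr_gt0 ?sqrtr_gt0 ?exprn_gt0.
exists (Num.sqrt (3 ^+ d) * (1 - r)^-1) => n.
have le1 k : (\int[mu]_x `|term c k x|%:E <= (geometric (Num.sqrt (3 ^+ d)) r k)%:E)%E.
  have s0 : (0 < size (shell d k))%N by rewrite size_cube expn_gt0.
  under eq_integral do rewrite /term normrM (ger0_norm (amp_ge0 k)) EFinM.
  rewrite ge0_integralZl//; last 2 first.
  - apply/measurable_EFinP; apply: measurableT_comp => //.
    exact: measurable_tsum.
  - by rewrite lee_fin amp_ge0.
  have := integral_abs_tsum c (cube_uniq _ _ : uniq (shell d k)) s0.
  move=> /(lee_wpmul2l (_ : 0 <= (amp k)%:E)%E) => /(_ _)/le_trans; apply.
    by rewrite lee_fin amp_ge0.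
  rewrite -EFinM lee_fin /geometric/= /r exprMn.
  have lamk : amp k <= lam ^+ k.
    rewrite /amp ler_pdivrMr// ler_peMr ?exprn_ge0 ?(ltW lam_gt0)// ler1n//.
  rewrite mulrCA; apply: ler_pM; rewrite ?amp_ge0 ?sqrtr_ge0//.
  have -> : Num.sqrt (2 ^+ d) ^+ k = Num.sqrt ((2 ^+ d) ^+ k) :> R.
    by elim: (k) => [|l IH]; rewrite ?sqrtr1// !exprS sqrtrM ?exprn_ge0// IH.
  by rewrite -sqrtrM ?exprn_ge0// ler_wsqrtr// size_shell.
apply: (@le_trans _ _ (\sum_(0 <= k < n) (geometric (Num.sqrt (3 ^+ d)) r k)%:E)%E).
  by apply: lee_sum => k _; exact: le1.
rewrite sumEFin lee_fin; apply: geometric_le_lim => //.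
by rewrite ger0_norm// ltW.
Qed.

Definition extremal x : R := fsum (term (fun=> 0)) x.

(** The value of [fsum] depends only on the sequence of terms at the point. So the translation is
    absorbed into the shifts at every [x], even where the series diverges. *)
Lemma extremal_shift x a :
  extremal (eadd x a) = fsum (term (fun v => 2 * pi * phase v a)) x.
Proof.
rewrite /extremal /fsum.
suff -> : term (fun=> 0) ^~ (eadd x a) = term (fun v => 2 * pi * phase v a) ^~ x by [].
apply/funext => k; rewrite /term /tsum; congr (_ * _).
by apply: eq_bigr => v _; rewrite wave_shift addr0.
Qed.

Lemma measurable_extremal_shift a : measurable_fun setT (fun x => extremal (eadd x a)).
Proof.
under eq_fun do rewrite extremal_shift.
by apply: measurable_fsum => k; exact: measurable_term.
Qed.

Lemma extremal_shift_integrable a (h : euclid R d -> R) (B : R) :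
  measurable_fun setT h -> (forall x, `|h x| <= B) ->
  mu.-integrable setT (EFin \o (fun x => extremal (eadd x a) * h x)).
Proof.
move=> mh hB; have [M sM] := term_summable (fun v => 2 * pi * phase v a).
under eq_fun do rewrite extremal_shift.
by apply: integrable_fsumM sM _ _ mh hB => k; exact: measurable_term.
Qed.

Lemma extremalM_integrable (h : euclid R d -> R) (B : R) :
  measurable_fun setT h -> (forall x, `|h x| <= B) ->
  mu.-integrable setT (EFin \o (fun x => extremal x * h x)).
Proof.
move=> mh hB; have [M sM] := term_summable (fun=> 0).
by apply: integrable_fsumM sM _ _ mh hB => k; exact: measurable_term.
Qed.

Lemma integral_tsumM (s : seq freq) c (h : euclid R d -> R) (B : R) :
  measurable_fun setT h -> (forall x, `|h x| <= B) ->
  \int[mu]_x (tsum s c x * h x) = \sum_(v <- s) \int[mu]_x (wave v (c v) x * h x).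
Proof.
move=> mh hB; under eq_Rintegral do rewrite /tsum mulr_suml.
rewrite Rintegral_sum// => v; apply: (@bounded_integrable _ _ _ (1 * B)).
  by apply: measurable_funM => //; exact: measurable_wave.
by move=> x; rewrite normrM ler_pM// wave_bound.
Qed.

Lemma integral_term (c : freq -> R) k (h : euclid R d -> R) (B : R) :
  measurable_fun setT h -> (forall x, `|h x| <= B) ->
  \int[mu]_x (term c k x * h x) =
  amp k * \sum_(v <- shell d k) \int[mu]_x (wave v (c v) x * h x).
Proof.
move=> mh hB; rewrite -(integral_tsumM _ _ mh hB).
under eq_Rintegral do rewrite /term -mulrA.
rewrite RintegralZl//; apply: (@bounded_integrable _ _ _ ((size (shell d k))%:R * B)).
  by apply: measurable_funM => //; exact: measurable_tsum.
by move=> x; rewrite normrM ler_pM// tsum_bound.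
Qed.

Lemma cvg_integral_extremal_shift a (h : euclid R d -> R) (B : R) :
  measurable_fun setT h -> (forall x, `|h x| <= B) ->
  series (fun k => amp k *
    \sum_(v <- shell d k) \int[mu]_x (wave v (2 * pi * phase v a) x * h x)) @ \oo -->
  \int[mu]_x (extremal (eadd x a) * h x).
Proof.
move=> mh hB; have [M sM] := term_summable (fun v => 2 * pi * phase v a).
under eq_Rintegral do rewrite extremal_shift.
have := cvg_integral_fsum (measurable_term _) sM mh hB (term_integrable _).
by under [X in series X]eq_fun do rewrite (integral_term _ _ mh hB).
Qed.

(** The frequencies [w] and [- w] lie in the same shells and contribute one half each. The choices
    [e = 0] and [e = pi / 2] give the real and imaginary parts of the Fourier coefficients. *)
Lemma cvg_integral_extremal_wave w (e : R) :
  series (fun k => amp k * (w \in shell d k)%:R * cos e) @ \oo -->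
  \int[mu]_x (extremal x * wave w e x).
Proof.
have mh := measurable_wave w e; have hB := wave_bound w e.
have [M sM] := term_summable (fun=> 0).
have := cvg_integral_fsum (measurable_term _) sM mh hB (term_integrable _).
under [X in series X]eq_fun do rewrite (integral_term _ _ mh hB).
suff E k : \sum_(v <- shell d k) \int[mu]_x (wave v 0 x * wave w e x) =
    (w \in shell d k)%:R * cos e.
  by under [X in series X]eq_fun do rewrite E mulrA.
have S u : \sum_(v <- shell d k) (v == u)%:R = (u \in shell d k)%:R :> R.
  have [us|us] := boolP (u \in shell d k).
    rewrite (bigD1_seq u) ?cube_uniq//= eqxx big1 ?addr0// => v /negbTE.
    by move->.
  rewrite big_seq big1// => v vs; case: eqP => // vu.
  by rewrite -vu vs in us.
under eq_bigr do rewrite integral_waveM sub0r add0r cosN.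
rewrite -mulr_sumr big_split/= -!mulr_suml !S mem_shellN.
by field.
Qed.

Lemma extremal_integrable : mu.-integrable setT (EFin \o extremal).
Proof.
have := @extremalM_integrable (fun=> 1) 1 (measurable_cst _) (fun=> _).
under eq_fun do rewrite mulr1.
by apply; rewrite normr1.
Qed.

Lemma extremal_periodic m x : extremal (eadd x (of_intvec R m)) = extremal x.
Proof.
rewrite extremal_shift /extremal /fsum.
suff -> : term (fun v => 2 * pi * phase v (of_intvec R m)) ^~ x = term (fun=> 0) ^~ x by [].
apply/funext => k; congr (_ * _); apply: eq_bigr => v _.
by rewrite phase_intvec /wave cosD2piz addr0.
Qed.

End extremal_function.

Lemma sum_inv_sqr_le (R : realFieldType) n : \sum_(0 <= k < n) (k.+1%:R ^+ 2)^-1 <= 2 :> R.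
Proof.
case: n => [|n]; first by rewrite big_nil.
(* The sharper bound is inductive, by comparison with a telescoping sum. *)
suff H : \sum_(0 <= k < n.+1) (k.+1%:R ^+ 2)^-1 <= 2 - n.+1%:R^-1 :> R.
  by rewrite (le_trans H)// gerBl.
elim: n => [|n IH]; first by rewrite big_nat1 expr1n invr1; lra.
rewrite big_nat_recr//=; apply: le_trans (lerD IH (lexx _)) _.
have n0 : 0 < n.+1%:R :> R by [].
rewrite -(natr1 n.+1); set x : R := n.+1%:R in n0 *.
have E : 2 - (x + 1)^-1 - (2 - x^-1 + ((x + 1) ^+ 2)^-1) = (x * (x + 1) ^+ 2)^-1.
  by field; rewrite !gt_eqF// ltr_wpDl// ltW.
by rewrite -subr_ge0 E invr_ge0 mulr_ge0 ?exprn_ge0 ?addr_ge0 ?(ltW n0).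
Qed.

Section sobolev_regularity.
Context (R : realType) (d : nat) (lam : R).
Local Notation mu := (torus_measure R d).
Local Notation freq := {ffun 'I_d -> int}.
Hypothesis lam_gt0 : 0 < lam.
Hypothesis lam_small : lam * Num.sqrt (2 ^+ d) < 1.
Local Notation ampl := (amp lam).
Local Notation extremal := (@extremal R d lam).

Definition cextremal (x : euclid R d) : R[i] := Complex (extremal x) 0.

Definition tuple_freq (m : d.-tuple int) : freq := [ffun i => tnth m i].

Lemma tuple_freq_inj : injective tuple_freq.
Proof.
move=> m n /ffunP mn; apply: eq_from_tnth => i.
by have := mn i; rewrite !ffunE.
Qed.

Lemma fourier_coef_extremal m : exists A : R,
  fourier_coef cextremal m = Complex A 0 /\
  series (fun k => ampl k * (tuple_freq m \in shell d k)%:R) @ \oo --> A.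
Proof.
exists (\int[mu]_x (extremal x * wave (tuple_freq m) 0 x)).
have c0 := cvg_integral_extremal_wave lam_gt0 lam_small (w := tuple_freq m) (e := 0).
have c1 := cvg_integral_extremal_wave lam_gt0 lam_small (w := tuple_freq m) (e := pi / 2).
split; last first.
  by move: c0; under [X in series X]eq_fun do rewrite cos0 mulr1.
rewrite /fourier_coef /torus_integral; congr Complex.
  apply: eq_Rintegral => x _ /=.
  by rewrite mul0r subr0 /wave addr0 edot_phase mulrN cosN.
transitivity (\int[mu]_x (extremal x * wave (tuple_freq m) (pi / 2) x)).
  apply: eq_Rintegral => x _ /=.
  by rewrite mul0r addr0 /wave cosDpihalf edot_phase mulrN sinN.
move: c1; under [X in series X]eq_fun do rewrite cos_pihalf mulr0.
have -> : series (fun=> 0 : R) = (fun=> 0) by apply/funext => n; rewrite /series/= big1.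
by move=> c1; rewrite -(cvg_lim (@Rhausdorff R) c1) lim_cst.
Qed.

(** From index [j] on, [1 / (k + 1)] is at most [1 / (j + 1)], so a geometric tail of ratio [lam]
    bounds the coefficient. *)
Lemma fourier_coef_le m (A : R) j :
  series (fun k => ampl k * (tuple_freq m \in shell d k)%:R) @ \oo --> A ->
  (forall k, (k < j)%N -> tuple_freq m \notin shell d k) ->
  0 <= A <= ampl j / (1 - lam).
Proof.
move=> cA mj; have lam1 := lam_lt1 lam_gt0 lam_small.
have lam0 := ltW lam_gt0.
apply/andP; split.
  apply: cvgr_to_ge cA _; apply: nearW => n; apply: sumr_ge0 => k _.
  by rewrite mulr_ge0 ?amp_ge0.
apply: cvgr_to_le cA _; apply: nearW => n.
(* Truncated subtraction makes the right side 0 for [n <= j], where the partial sum vanishes as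
   well. *)
suff H : series (fun k => ampl k * (tuple_freq m \in shell d k)%:R) n <=
    ampl j * (1 - lam ^+ (n - j)) / (1 - lam).
  apply: le_trans H _; rewrite ler_wpM2r ?invr_ge0 ?subr_ge0 ?(ltW lam1)//.
  by rewrite ler_piMr ?amp_ge0// gerBl exprn_ge0.
elim: n => [|n IH]; first by rewrite /series/= big_nil sub0n subrr mulr0 mul0r.
rewrite /series/= big_nat_recr//=; have [nj|jn] := ltnP n j.
  rewrite (negbTE (mj n nj)) mulr0 addr0; apply: le_trans IH _.
  have /eqP -> : (n.+1 - j == 0)%N by rewrite subn_eq0.
  by have /eqP -> : (n - j == 0)%N by rewrite subn_eq0 ltnW.
apply: le_trans (lerD IH (_ : _ <= ampl j * lam ^+ (n - j))) _.
  apply: (@le_trans _ _ (ampl n)); first by rewrite ler_piMr ?amp_ge0// lern1 leq_b1.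
  rewrite /amp mulrAC -exprD subnKC// ler_wpM2l ?exprn_ge0//.
  by rewrite lef_pV2 ?posrE// ler_nat.
rewrite subSn// exprS le_eqVlt; apply/orP; left; apply/eqP.
by field; rewrite subr_eq0 gt_eqF.
Qed.

Lemma shell_exists (w : freq) : exists k, w \in shell d k.
Proof.
exists (\sum_i `|w i|)%N; rewrite mem_cube; apply/forallP => i.
rewrite (leq_trans _ (ltnW (ltn_expl _ (ltnSn 1))))//.
by rewrite (bigD1 i)//= leq_addr.
Qed.

Lemma edot_shell (m : d.-tuple int) j : tuple_freq m \in shell d j ->
  edot (of_intvec R m) (of_intvec R m) <= d%:R * 4 ^+ j.
Proof.
rewrite mem_cube => /forallP mj.
rewrite /edot -[d in leRHS]card_ord -sum1_card natr_sum mulr_suml.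
apply: ler_sum => i _; rewrite tnth_mktuple mul1r -expr2.
rewrite -(real_normK (num_real _)) -intr_norm (_ : 4 = 2 ^+ 2 :> R); last by rewrite -natrX.
rewrite exprAC lerXn2r ?nnegrE ?exprn_ge0// -abszE -natrX.
by have := mj i; rewrite ffunE ler_nat.
Qed.

Variable delta : R.
Hypothesis delta_ge0 : 0 <= delta.
Hypothesis delta_small : 4 `^ delta * 2 ^+ d * lam ^+ 2 <= 1.

Let C : R := (1 + d%:R) `^ delta / (1 - lam) ^+ 2.

(** The factor [(2 ^ d) ^ (- j)] offsets the number of frequencies in shell [j], leaving the
    summable [1 / (j + 1) ^ 2]. *)
Let b (j : nat) : R := C * ((2 ^+ d) ^+ j)^-1 / j.+1%:R ^+ 2.

Let h (m : d.-tuple int) : R :=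
  (1 + edot (of_intvec R m) (of_intvec R m)) `^ delta
       * ComplexField.Normc.normc (fourier_coef cextremal m) ^+ 2.

Let C_ge0 : 0 <= C.
Proof. by rewrite divr_ge0 ?powR_ge0// sqr_ge0. Qed.

Let b_ge0 j : 0 <= b j.
Proof. by rewrite divr_ge0// ?sqr_ge0// mulr_ge0 ?C_ge0// invr_ge0 !exprn_ge0. Qed.

(** Take the first shell containing the frequency. There the weight is at most
    [(1 + d) ^ delta * 4 ^ (delta j)] and the coefficient at most [ampl j / (1 - lam)];
    [delta_small] absorbs the exponentials. *)
Let h_le m : exists j, tuple_freq m \in shell d j /\ h m <= b j.
Proof.
have [j mj min_j] := ex_minnP (shell_exists (tuple_freq m)).
exists j; split=> //.
have [A [fA cA]] := fourier_coef_extremal m.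
have /andP[A0 Aj] : 0 <= A <= ampl j / (1 - lam).
  apply: fourier_coef_le cA _ => k kj; apply/negP => /min_j; rewrite leqNgt.
  by rewrite kj.
have lam1 := lam_lt1 lam_gt0 lam_small.
rewrite /h fA /= expr0n addr0 sqrtr_sqr ger0_norm//.
have e0 : 0 <= edot (of_intvec R m) (of_intvec R m).
  by apply: sumr_ge0 => i _; rewrite -expr2 sqr_ge0.
have j41 : 1 <= 4 ^+ j :> R by rewrite exprn_ege1// ler1n.
have H1 : (1 + edot (of_intvec R m) (of_intvec R m)) `^ delta <=
    (1 + d%:R) `^ delta * (4 `^ delta) ^+ j.
  have -> : (4 `^ delta) ^+ j = (4 ^+ j) `^ delta :> R.
    by rewrite -!powR_mulrn ?powR_ge0// -!powRrM mulrC.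
  rewrite -powRM ?addr_ge0// ?exprn_ge0//.
  apply: ge0_ler_powR; rewrite ?nnegrE ?addr_ge0 ?mulr_ge0 ?addr_ge0 ?exprn_ge0//.
  by rewrite mulrDl mul1r lerD// edot_shell.
apply: le_trans (ler_pM (powR_ge0 _ _) (sqr_ge0 _) H1 (lerXn2r 2 _ _ Aj)) _; rewrite ?nnegrE//.
  by rewrite (le_trans A0).
have -> : (1 + d%:R) `^ delta * (4 `^ delta) ^+ j * (ampl j / (1 - lam)) ^+ 2 =
    C / j.+1%:R ^+ 2 * (4 `^ delta * lam ^+ 2) ^+ j.
  rewrite /C /amp [in RHS]exprMn [(lam ^+ 2) ^+ j]exprAC.
  by field; rewrite nat1r pnatr_eq0/= subr_eq0 (gt_eqF lam1).
rewrite /b /= [leRHS]mulrAC ler_wpM2l//; first by rewrite divr_ge0 ?sqr_ge0 ?C_ge0.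
rewrite -exprVn lerXn2r ?nnegrE ?mulr_ge0 ?powR_ge0 ?sqr_ge0 ?invr_ge0 ?exprn_ge0 ?(ltW lam_gt0)//.
by rewrite -[leRHS]mul1r ler_pdivlMr ?exprn_gt0// mulrAC.
Qed.

Let sum_h_le (s : seq (d.-tuple int)) : uniq s ->
  \sum_(m <- s) h m <= 2 * (C * 3 ^+ d).
Proof.
move=> us.
(* Spreading the bound over all shells containing the frequency overcounts harmlessly and allows the
   order of summation to be exchanged, so that only shell sizes matter. *)
have [J hJ] : exists J, forall m, m \in s ->
    h m <= \sum_(0 <= k < J) (tuple_freq m \in shell d k)%:R * b k.
  elim: {us} s => [|m s [J IH]]; first by exists 0%N.
  have [j [mj hj]] := h_le m.
  have mono J1 J2 n : (J1 <= J2)%N ->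
      \sum_(0 <= k < J1) (tuple_freq n \in shell d k)%:R * b k <=
      \sum_(0 <= k < J2) (tuple_freq n \in shell d k)%:R * b k.
    move=> J12; rewrite [leRHS](big_cat_nat (n := J1))//= lerDl sumr_ge0// => k _.
    by rewrite mulr_ge0.
  exists (maxn J j.+1) => n; rewrite inE => /predU1P[->|ns].
    apply: le_trans hj (le_trans _ (mono j.+1 _ _ (leq_maxr _ _))).
    by rewrite big_nat_recr//= mj mul1r lerDr sumr_ge0// => k _; rewrite mulr_ge0.
  exact: le_trans (IH n ns) (mono J _ _ (leq_maxl _ _)).
rewrite big_seq; apply: le_trans (ler_sum _ hJ) _; rewrite -big_seq exchange_big/=.
have count k : \sum_(m <- s) (tuple_freq m \in shell d k)%:R <= 3 ^+ d * (2 ^+ d) ^+ k :> R.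
  apply: (le_trans _ (size_shell d R k)); rewrite -natr_sum -big_mkcond/= sum1_count -size_filter.
  rewrite ler_nat -(size_map tuple_freq); apply: uniq_leq_size.
    by rewrite map_inj_uniq ?filter_uniq//; exact: tuple_freq_inj.
  by move=> _ /mapP[m + ->]; rewrite mem_filter => /andP[].
apply: (@le_trans _ _ (\sum_(0 <= k < J) (C * 3 ^+ d) * (k.+1%:R ^+ 2)^-1)).
  apply: ler_sum => k _; rewrite -mulr_suml.
  apply: le_trans (ler_wpM2r (b_ge0 k) (count k)) _.
  rewrite /b le_eqVlt; apply/orP; left; apply/eqP.
  by field; rewrite nat1r pnatr_eq0/= !expf_neq0 ?pnatr_eq0.
rewrite -mulr_sumr mulrC ler_wpM2r ?sum_inv_sqr_le// mulr_ge0 ?C_ge0// exprn_ge0//.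
Qed.

Lemma extremal_in_sobolev : in_sobolev delta cextremal.
Proof.
split.
- by move=> m x; rewrite /cextremal extremal_periodic.
- split; first exact: extremal_integrable.
  by apply: (@bounded_integrable _ _ (fun=> 0) 0) => [|x]; [exact: measurable_cst|rewrite normr0].
rewrite /sobolev_norm poweR_lty//.
apply: le_lt_trans (ltry (2 * (C * 3 ^+ d))); apply: ge_ereal_sup => _ [X [finX _] <-].
rewrite fsbig_finite//= sumEFin lee_fin; apply: sum_h_le; exact: finmap.fset_uniq.
Qed.

End sobolev_regularity.

(** * Lower bound for the discrepancy *)

Lemma Rintegral_weight_le dd (T : measurableType dd) (R : realType)
    (mu : {measure set T -> \bar R}) (g K : T -> R) (S : R) :
  measurable_fun setT g -> measurable_fun setT K -> (forall x, 0 <= K x) ->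
  mu.-integrable setT (EFin \o K) ->
  mu.-integrable setT (EFin \o (fun x => g x * K x)) ->
  {ae mu, forall x, g x <= S} ->
  \int[mu]_x (g x * K x) <= S * \int[mu]_x K x.
Proof.
move=> mg mK K0 iK igK gS.
have iSK : mu.-integrable setT (EFin \o (fun x => S * K x)).
  have := @integrableZl _ _ _ mu _ measurableT S _ iK.
  by apply: eq_integrable => // x _.
have mgK : measurable_fun setT (fun x => S * K x - g x * K x).
  apply: measurable_funB; last exact: measurable_funM.
  by apply: measurable_funM => //; exact: measurable_cst.
rewrite -subr_ge0 -RintegralZl// -RintegralB//.
(* The bound by [S] holds only almost everywhere; [h] repairs the integrand on a null set so that it
   is nonnegative at every point. *)
pose h x := Num.max 0 (S * K x - g x * K x).
have -> : \int[mu]_x (S * K x - g x * K x) = \int[mu]_x h x.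
  congr fine; apply: ae_eq_integral => //.
  - exact/measurable_EFinP.
  - by apply/measurable_EFinP; apply: measurable_maxr => //; exact: measurable_cst.
  - apply: filterS gS => x gS _; congr (_%:E); rewrite /h max_r//.
    by rewrite -mulrBl mulr_ge0// subr_ge0.
by apply: Rintegral_ge0 => x _; rewrite /h le_max lexx.
Qed.

Section discrepancy_lower_bound.
Context (R : realType) (d : nat) (lam : R).
Local Notation mu := (torus_measure R d).
Local Notation freq := {ffun 'I_d -> int}.
Hypothesis lam_gt0 : 0 < lam.
Hypothesis lam_small : lam * Num.sqrt (2 ^+ d) < 1.
Local Notation ampl := (amp lam).
Local Notation extremal := (@extremal R d lam).
Variables (s : seq int) (phi : int -> R) (a : euclid R d).

(** The extremal function is real, so this is the real part of the discrepancy once [phi] is the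
    real part of the weights. *)
Definition rdiscrepancy (x : euclid R d) : R :=
  \sum_(n <- s) phi n * extremal (eadd x (emulz a n)) - \int[mu]_y extremal y.

Definition symbol (t : R) : R := \sum_(n <- s) phi n * cos (2 * pi * (n%:~R * t)).

Lemma measurable_rdiscrepancy : measurable_fun setT rdiscrepancy.
Proof.
apply: measurable_funB; last exact: measurable_cst.
apply: measurable_sum => n; apply: measurable_funM; first exact: measurable_cst.
exact: measurable_extremal_shift.
Qed.

Let kernel_integrable L n :
  mu.-integrable setT (EFin \o (fun x => phi n * (extremal (eadd x (emulz a n)) * fejer L x))).
Proof.
have := @integrableZl _ _ _ mu _ measurableT (phi n) _
  (extremal_shift_integrable lam_gt0 lam_small (emulz a n)
     (@measurable_fejer R d L) (@fejer_bound R d L)).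
by apply: eq_integrable => // x _.
Qed.

Let fejer_integrable L : mu.-integrable setT (EFin \o @fejer R d L).
Proof. exact: bounded_integrable (@measurable_fejer R d L) (@fejer_bound R d L). Qed.

Let sum_integrable L : mu.-integrable setT
  (EFin \o (fun x => \sum_(n <- s) phi n * (extremal (eadd x (emulz a n)) * fejer L x))).
Proof.
have -> : EFin \o (fun x => \sum_(n <- s) phi n * (extremal (eadd x (emulz a n)) * fejer L x)) =
    (fun x => \sum_(n <- s) (phi n * (extremal (eadd x (emulz a n)) * fejer L x))%:E)%E.
  by apply/funext => x /=; rewrite sumEFin.
by apply: integrable_sum => // n _; exact: kernel_integrable.
Qed.

Let cst_integrable L (c : R) : mu.-integrable setT (EFin \o (fun x => c * fejer L x)).
Proof.
have := @integrableZl _ _ _ mu _ measurableT c _ (@fejer_integrable L).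
by apply: eq_integrable => // x _.
Qed.

Let rdiscrepancyM L x : rdiscrepancy x * fejer L x =
  \sum_(n <- s) phi n * (extremal (eadd x (emulz a n)) * fejer L x) -
    (\int[mu]_y extremal y) * fejer L x.
Proof.
rewrite /rdiscrepancy mulrBl mulr_suml; congr (_ - _).
by apply: eq_bigr => n _; rewrite mulrA.
Qed.

Lemma rdiscrepancy_integrable L :
  mu.-integrable setT (EFin \o (fun x => rdiscrepancy x * fejer L x)).
Proof.
have := @integrableB _ _ _ mu _ measurableT _ _ (sum_integrable L)
  (cst_integrable L (\int[mu]_y extremal y)).
by apply: eq_integrable => // x _ /=; rewrite rdiscrepancyM EFinB.
Qed.

(** Translating by [n a] and integrating against the even kernel turns the wave of frequency [v]
    into [cos (2 pi n v . a)], and summing over [n] yields [symbol]. The [- 1] in each shell comes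
    from the mean of the extremal function, which is the sum of the [ampl k]. *)
Lemma cvg_integral_rdiscrepancy L : (0 < L)%N ->
  series (fun k => ampl k *
    (\sum_(v <- shell d k) fejer_coef R L v * symbol (phase v a) - 1)) @ \oo -->
  \int[mu]_x (rdiscrepancy x * fejer L x).
Proof.
move=> L0.
have -> : \int[mu]_x (rdiscrepancy x * fejer L x) =
    \sum_(n <- s) phi n * \int[mu]_x (extremal (eadd x (emulz a n)) * fejer L x) -
    \int[mu]_x extremal x.
  under eq_Rintegral do rewrite rdiscrepancyM.
  rewrite RintegralB// RintegralZl// integral_fejer// mulr1; congr (_ - _).
  rewrite Rintegral_sum; last exact: kernel_integrable.
  apply: eq_bigr => n _; rewrite RintegralZl//.
  exact: (extremal_shift_integrable lam_gt0 lam_small _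
    (@measurable_fejer R d L) (@fejer_bound R d L)).
pose u n k := ampl k * \sum_(v <- shell d k)
  \int[mu]_x (wave v (2 * pi * phase v (emulz a n)) x * fejer L x).
have cu n : series (u n) @ \oo -->
    \int[mu]_x (extremal (eadd x (emulz a n)) * fejer L x).
  have mh := @measurable_fejer R d L; have hB := @fejer_bound R d L.
  exact: (cvg_integral_extremal_shift lam_gt0 lam_small (a := emulz a n) mh hB).
have csum (r : seq int) : (fun J => \sum_(n <- r) phi n * series (u n) J) @ \oo -->
    \sum_(n <- r) phi n * \int[mu]_x (extremal (eadd x (emulz a n)) * fejer L x).
  elim: r => [|n r IH].
    by rewrite big_nil; under eq_fun do rewrite big_nil; exact: cvg_cst.
  rewrite big_cons; under eq_fun do rewrite big_cons.
  by apply: cvgD => //; apply: cvgM; [exact: cvg_cst|exact: cu].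
have camp : series ampl @ \oo --> \int[mu]_x extremal x.
  have := cvg_integral_extremal_wave lam_gt0 lam_small (w := 0 : freq) (e := 0).
  under [X in series X]eq_fun do rewrite mem_shell0 mulr1 cos0 mulr1.
  by under eq_Rintegral do rewrite /wave phase0 mulr0 addr0 cos0 mulr1.
have -> : series (fun k => ampl k *
    (\sum_(v <- shell d k) fejer_coef R L v * symbol (phase v a) - 1)) =
    (fun J => \sum_(n <- s) phi n * series (u n) J - series ampl J).
  apply/funext => J; rewrite /series/=.
  under [in RHS]eq_bigr do rewrite mulr_sumr.
  rewrite exchange_big/= -sumrB; apply: eq_bigr => k _.
  rewrite mulrBr mulr1; congr (_ - _).
  under [in RHS]eq_bigr do rewrite /u mulrCA.
  rewrite -mulr_sumr; congr (_ * _).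
  under [in RHS]eq_bigr do rewrite mulr_sumr.
  rewrite exchange_big/=; apply: eq_bigr => v _.
  rewrite /symbol mulr_sumr; apply: eq_bigr => n _.
  by rewrite integral_wave_fejer phase_emulz mulrCA.
exact: cvgB.
Qed.

Hypothesis phi_sum : \sum_(n <- s) phi n = 1.

(** The zero frequency cancels the [- 1], and all other contributions are nonnegative. So it is
    enough to keep the single frequency [v k] in each of the first [n] shells; the kernel of order
    [2 * 2 ^ n] has coefficient at least [2 ^ (- d)] there. *)
Lemma integral_rdiscrepancy_ge (l : R -> R) (v : nat -> freq) (n : nat) :
  (forall t, 0 <= l t <= symbol t) ->
  (forall k, v k \in shell d k /\ v k != 0) ->
  (2 ^ d)%:R^-1 * \sum_(0 <= k < n) ampl k * l (phase (v k) a) <=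
  \int[mu]_x (rdiscrepancy x * fejer (2 ^ n).*2 x).
Proof.
move=> lP vP; set L := (2 ^ n).*2.
have L0 : (0 < L)%N by rewrite double_gt0 expn_gt0.
have symbol_ge0 t : 0 <= symbol t by have /andP[/le_trans] := lP t; apply.
pose u k := \sum_(v <- shell d k) fejer_coef R L v * symbol (phase v a) - 1.
have uE k : u k = \sum_(v <- shell d k | v != 0) fejer_coef R L v * symbol (phase v a).
  rewrite /u (bigD1_seq 0) ?mem_shell0 ?cube_uniq//= fejer_coef0// mul1r phase0.
  have -> : symbol 0 = 1.
    rewrite -[RHS]phi_sum /symbol; apply: eq_bigr => i _.
    by rewrite !mulr0 cos0 mulr1.
  by rewrite addrAC subrr add0r.
have u0 k : 0 <= u k.
  by rewrite uE sumr_ge0// => w _; rewrite mulr_ge0 ?fejer_coef_ge0.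
have un k : (k < n)%N -> (2 ^ d)%:R^-1 * l (phase (v k) a) <= u k.
  move=> kn; have [vk vk0] := vP k; have /andP[l0 ls] := lP (phase (v k) a).
  rewrite uE -big_filter (bigD1_seq (v k)) ?filter_uniq ?cube_uniq//=; last first.
    by rewrite mem_filter vk0.
  rewrite -[leLHS]addr0 lerD//; last first.
    by apply: sumr_ge0 => w _; rewrite mulr_ge0 ?fejer_coef_ge0.
  rewrite ler_pM ?invr_ge0// fejer_coef_cube ?expn_gt0//.
  exact: shell_mono (ltnW kn) _ vk.
apply: cvgr_to_ge (cvg_integral_rdiscrepancy L0) _.
near=> J.
have nJ : (n <= J)%N by near: J; exact: nbhs_infty_ge.
rewrite /series/= [leRHS](big_cat_nat (n := n))//= -[leLHS]addr0 lerD//; last first.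
  by rewrite sumr_ge0// => k _; rewrite mulr_ge0 ?amp_ge0// u0.
rewrite mulr_sumr !big_mkord; apply: ler_sum => k _.
by rewrite mulrCA ler_wpM2l ?amp_ge0// un.
Unshelve. all: by end_near. Qed.

End discrepancy_lower_bound.

(** * Upper limits, the harmonic series and finite sums over the integers *)

Lemma limn_esup_pinfty (R : realType) (u : nat -> \bar R) :
  (forall (K : R) n0, exists2 N, (n0 <= N)%N & (K%:E <= u N)%E) ->
  limn_esup u = +oo%E.
Proof.
move=> uP; apply/eqyP => K K0; apply: le_ereal_inf_tmp => _ [V [n0 _ Vn0] <-].
have [N n0N KN] := uP K n0.
by apply: le_trans KN (ereal_sup_ubound _); exists N => //; exact: Vn0.
Qed.

Lemma harmonic_unbounded (R : realType) (K : R) :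
  exists n, K <= \sum_(0 <= k < n) k.+1%:R^-1.
Proof.
apply: contrapT => H; apply: (@dvg_harmonic R).
apply: nondecreasing_is_cvgn; first by apply: nondecreasing_series => k _ _; exact: harmonic_ge0.
exists K => _ [n _ <-]; rewrite leNgt; apply/negP => Kn.
by apply: H; exists n; exact: ltW.
Qed.

Lemma infinite_unbounded (A : set nat) n0 : infinite_set A -> exists2 N, A N & (n0 <= N)%N.
Proof.
move=> infA; apply: contrapT => H; apply: infA.
apply: (sub_finite_set _ (finite_II n0)) => N AN /=.
by rewrite ltnNge; apply/negP => n0N; apply: H; exists N.
Qed.

Definition symint (M : nat) : seq int := [seq i%:Z - M%:Z | i <- iota 0 M.*2.+1].

Lemma fsbig_symint (V : nmodType) (M : nat) (F : int -> V) :
  (forall n : int, (M < `|n|)%N -> F n = 0) ->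
  \sum_(n \in [set: int]) F n = \sum_(n <- symint M) F n.
Proof.
move=> F0; rewrite [RHS]fsbig_seq; last first.
  by rewrite map_inj_uniq ?iota_uniq// => i j; lia.
apply/esym/fsbig_widen => // n [_ /= nM]; apply: F0; rewrite ltnNge.
apply/negP => nM'; apply: nM; apply/mapP; exists (absz (n + M%:Z)); last by lia.
by rewrite mem_iota; lia.
Qed.

Section complex_sums.
Context (R : realType).

Lemma Re_sum (I : Type) (r : seq I) (F : I -> R[i]) :
  complex.Re (\sum_(i <- r) F i) = \sum_(i <- r) complex.Re (F i).
Proof.
elim: r => [|i r IH]; first by rewrite !big_nil.
by rewrite !big_cons -IH; case: (F i) => ? ?; case: (\sum_(_ <- _) _).
Qed.

Lemma Re_le_normc (z : R[i]) : complex.Re z <= ComplexField.Normc.normc z.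
Proof.
case: z => x y /=; apply: le_trans (ler_norm x) _.
by rewrite -sqrtr_sqr ler_wsqrtr// lerDl sqr_ge0.
Qed.

Lemma normc_ge0 (z : R[i]) : 0 <= ComplexField.Normc.normc z.
Proof. by case: z => x y /=; exact: sqrtr_ge0. Qed.

End complex_sums.

Section weighted_discrepancy.
Context (R : realType) (d : nat) (lam theta H : R) (N : nat) (w : int -> R[i]).
Local Notation mu := (torus_measure R d).
Hypothesis lam_gt0 : 0 < lam.
Hypothesis lam_small : lam * Num.sqrt (2 ^+ d) < 1.
Hypothesis H_gt0 : 0 < H.
Variable M : nat.
Hypothesis w_supp : forall n : int, (M < `|n|)%N -> w n = 0.
Hypothesis w_sum : \sum_(n \in [set: int]) w n = 1.
Hypothesis w_lower : forall t : R, H * (1 + N%:R * dist_int t) `^ (- theta)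
  <= complex.Re (\sum_(n \in [set: int]) w n * expi2pi (n%:~R * t)).

Let phi n := complex.Re (w n).

Let phi_sum : \sum_(n <- symint M) phi n = 1.
Proof. by rewrite -Re_sum -fsbig_symint// w_sum. Qed.

(* Averaging over [t] and [-t] removes the imaginary parts of the weights. *)
Let symbol_ge t : H * (1 + N%:R * dist_int t) `^ (- theta) <= symbol (symint M) phi t.
Proof.
have E u : H * (1 + N%:R * dist_int u) `^ (- theta) <= \sum_(n <- symint M)
    (phi n * cos (2 * pi * (n%:~R * u)) - complex.Im (w n) * sin (2 * pi * (n%:~R * u))).
  have := w_lower u; rewrite (@fsbig_symint _ M); last by move=> n /w_supp ->; rewrite mul0r.
  rewrite Re_sum; congr (_ <= _); apply: eq_bigr => n _.
  by rewrite /phi; case: (w n).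
have := E (- t); rewrite dist_intN => E1.
have := lerD (E t) E1; rewrite -big_split/=.
rewrite (eq_bigr (fun n => 2 * (phi n * cos (2 * pi * (n%:~R * t))))); last first.
  by move=> n _; rewrite !mulrN cosN sinN; ring.
by rewrite -mulr_sumr -/(symbol _ _ t); lra.
Qed.

Let Re_discrepancy (a x : euclid R d) :
  complex.Re (discrepancy (fun=> w) a N (@cextremal R d lam) x) =
  rdiscrepancy lam (symint M) phi a x.
Proof.
rewrite /discrepancy (@fsbig_symint _ M); last by move=> n /w_supp ->; rewrite mul0r.
rewrite /rdiscrepancy /torus_integral /=.
have ReB (z : R[i]) b c : complex.Re (z - Complex b c) = complex.Re z - b by case: z.
rewrite ReB Re_sum; congr (_ - _); apply: eq_bigr => n _.
by rewrite /phi /cextremal; case: (w n) => p q /=; rewrite mulr0 subr0.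
Qed.

(** The Fejer kernel is nonnegative of integral 1, so the average of the real part against it is at
    most the essential supremum. The family [fun=> w] is constant because [N] is fixed here. *)
Lemma sup_discrepancy_ge (a : euclid R d) (v : nat -> {ffun 'I_d -> int}) n :
  (forall k, v k \in shell d k /\ v k != 0) ->
  (((2 ^ d)%:R^-1 * \sum_(0 <= k < n) amp lam k *
     (H * (1 + N%:R * dist_int (phase (v k) a)) `^ (- theta)))%:E <=
   sup_discrepancy (fun=> w) a N (@cextremal R d lam))%E.
Proof.
move=> vP; have lP t : 0 <= H * (1 + N%:R * dist_int t) `^ (- theta) <= symbol (symint M) phi t.
  by rewrite symbol_ge andbT mulr_ge0 ?powR_ge0// ltW.
have L0 : (0 < (2 ^ n).*2)%N by rewrite double_gt0 expn_gt0.
have := integral_rdiscrepancy_ge lam_gt0 lam_small a phi_sum n lP vP.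
set X := _ * _; set I := Rintegral _ _ _ => XI.
set S := sup_discrepancy _ _ _ _.
have S_ae : {ae mu, forall x, ((rdiscrepancy lam (symint M) phi a x)%:E <= S)%E}.
  apply: filterS (ess_sup_ge _ _) => x; apply: le_trans.
  by rewrite lee_fin -Re_discrepancy Re_le_normc.
have S0 : (0 <= S)%E.
  apply: ess_sup_gee; first by rewrite [X in (_ < X)%E]torus_measureT.
  by apply: aeW => x; rewrite lee_fin normc_ge0.
(* Only a finite [S] needs work: [S0] excludes [-oo], and [+oo] bounds everything. *)
move: S S_ae S0 => [S||] // S_ae _; last by rewrite leey.
rewrite lee_fin; apply: le_trans XI _.
rewrite -[leRHS]mulr1 -(integral_fejer R d L0); apply: Rintegral_weight_le.
- exact: measurable_rdiscrepancy.
- exact: measurable_fejer.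
- exact: fejer_ge0.
- exact: bounded_integrable (@measurable_fejer R d _) (@fejer_bound R d _).
- exact: rdiscrepancy_integrable.
- exact: S_ae.
Qed.

End weighted_discrepancy.

(** * Arithmetic of the exponents *)

Section decay_rate.
Context (R : realType) (d : nat) (theta : R).
Hypothesis d_gt0 : (0 < d)%N.

(** Chosen so that [decay ^ k = D ^ (- theta)], where [D = 2 ^ (k d)] is the precision that
    Dirichlet's theorem gives in shell [k]. *)
Definition decay : R := 2 `^ (- (d%:R * theta)).

Lemma decay_gt0 : 0 < decay.
Proof. exact: powR_gt0. Qed.

Lemma decay_sqrt : 1 / 2 < theta -> decay * Num.sqrt (2 ^+ d) < 1.
Proof.
move=> ht; rewrite -powR12_sqrt ?exprn_ge0// -powR_mulrn// -powRrM -powRD; last first.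
  by rewrite pnatr_eq0 implybT.
rewrite /powR pnatr_eq0/= -[ltRHS]expR0 ltr_expR pmulr_llt0 ?ln_gt0 ?ltr1n//.
have d0 : 0 < d%:R :> R by rewrite ltr0n.
rewrite -subr_gt0 in ht; have := mulr_gt0 d0 ht.
by rewrite mulrBr; lra.
Qed.

(** The left side is 2 to the power [2 delta + d - 2 d theta]; equality is allowed, which serves the
    endpoint exponent. *)
Lemma decay_sobolev delta : delta <= d%:R * theta - d%:R / 2 ->
  4 `^ delta * 2 ^+ d * decay ^+ 2 <= 1.
Proof.
move=> hdelta.
have -> : 4 = 2 `^ 2%:R :> R by rewrite powR_mulrn// -natrX.
rewrite -powRrM -[2 ^+ d]powR_mulrn// -[decay ^+ 2]powR_mulrn ?powR_ge0// /decay -powRrM.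
have two_neq0 (x : R) : (x == 0) ==> (2 != 0 :> R) by rewrite pnatr_eq0 implybT.
rewrite -!powRD ?two_neq0// -[leRHS](powRr0 (2 : R)); apply: ler_powR; first by rewrite ler1n.
by lra.
Qed.

(** With [D = 2 ^ (k d)], both [1] and [N t] are at most [N / D], so the base is at most [2 N / D];
    the powers of [N] and [D] then cancel. *)
Lemma decay_term (N k : nat) (t : R) : 0 < theta ->
  0 <= t <= ((2 ^ k)%:R ^+ d)^-1 -> ((2 ^ k) ^ d <= N)%N ->
  2 `^ (- theta) <= N%:R `^ theta * (decay ^+ k * (1 + N%:R * t) `^ (- theta)).
Proof.
move=> th0 /andP[t0 tD] DN; rewrite -natrX in tD; set D : R := ((2 ^ k) ^ d)%:R in tD.
have D0 : 0 < D by rewrite ltr0n !expn_gt0.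
have DN' : D <= N%:R by rewrite ler_nat.
have N0 : 0 < N%:R :> R by exact: lt_le_trans DN'.
have lamD : decay ^+ k * D `^ theta = 1.
  rewrite /D !natrX -!powR_mulrn ?powR_ge0// /decay -!powRrM -powRD; last first.
    by rewrite pnatr_eq0 implybT.
  by rewrite (_ : _ + _ = 0) ?powRr0//; ring.
have base : 1 + N%:R * t <= 2 * N%:R / D.
  have h1 : N%:R * t <= N%:R / D by rewrite ler_wpM2l// ltW.
  have h2 : 1 <= N%:R / D by rewrite ler_pdivlMr// mul1r.
  by rewrite -mulrA; lra.
have b0 : 0 < 1 + N%:R * t by rewrite ltr_pwDl// mulr_ge0// ltW.
have pw : (2 * N%:R / D) `^ (- theta) <= (1 + N%:R * t) `^ (- theta).
  rewrite !powRN lef_pV2 ?posrE ?powR_gt0//; last by rewrite divr_gt0// mulr_gt0.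
  apply: ge0_ler_powR => //; rewrite ?nnegrE ltW//.
  by rewrite divr_gt0// mulr_gt0.
have -> : 2 `^ (- theta) = N%:R `^ theta * (decay ^+ k * (2 * N%:R / D) `^ (- theta)).
  rewrite powRM ?mulr_ge0 ?invr_ge0 ?ltW// powRM ?ltW// -(powR_inv1 (ltW D0)) -powRrM mulN1r opprK.
  rewrite [N%:R `^ (- theta)]powRN.
  have Nt : N%:R `^ theta != 0 by rewrite gt_eqF ?powR_gt0.
  transitivity (2 `^ (- theta) * (decay ^+ k * D `^ theta)); first by rewrite lamD mulr1.
  by field.
by rewrite !ler_wpM2l ?powR_ge0 ?exprn_ge0 ?(ltW decay_gt0).
Qed.

End decay_rate.

Theorem theorem1p5 (R : realType) (d : nat) (theta : R)
    (Phi : nat -> int -> R[i]) (H : R) (A : set nat)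
    (hd : (1 <= d)%N) (htheta : 0 < theta)
    (Phi_bounded_support : forall N : nat, (1 <= N)%N ->
      exists M : nat, forall n : int, (M < `|n|)%N -> Phi N n = 0)
    (Phi_sum1 : forall N : nat, (1 <= N)%N ->
      \sum_(n \in [set: int]) Phi N n = 1)
    (hH : 0 < H) (A_infinite : infinite_set A)
    (A_pos : forall N : nat, A N -> (1 <= N)%N)
    (Phi_lower : forall N : nat, A N -> forall t : R,
      complex.Im (\sum_(n \in [set: int]) Phi N n * expi2pi (n%:~R * t)) = 0 /\
      H * (1 + N%:R * dist_int t) `^ (- theta)
        <= complex.Re (\sum_(n \in [set: int]) Phi N n * expi2pi (n%:~R * t))) :
  (forall delta : R, 0 < delta -> delta < d%:R * theta - d%:R / 2 ->
     exists f : euclid R d -> R[i],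
       in_sobolev delta f /\
       forall alpha : euclid R d,
         limn_esup (fun N : nat =>
           ((N%:R `^ theta)%:E * sup_discrepancy Phi alpha N f)%E) = +oo%E) /\
  (1 / 2 < theta ->
     exists f : euclid R d -> R[i],
       in_sobolev (d%:R * theta - d%:R / 2) f /\
       {ae lebesgue_euclid R d, forall alpha : euclid R d,
         limn_esup (fun N : nat =>
           ((N%:R `^ theta)%:E * sup_discrepancy Phi alpha N f)%E) = +oo%E}).
Proof.
pose f : euclid R d -> R[i] := @cextremal R d (decay d theta).
(* Divergence for every [alpha], which serves both parts of the theorem. *)
have main (htheta' : 1 / 2 < theta) alpha : limn_esup (fun N : nat =>
    ((N%:R `^ theta)%:E * sup_discrepancy Phi alpha N f)%E) = +oo%E.
  have lam0 := decay_gt0 d theta; have lam1 := decay_sqrt hd htheta'.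
  (* These frequencies depend on [alpha] and [k] but not on [N]. *)
  have /choice[v vP] : forall k, exists v : {ffun 'I_d -> int},
      [/\ v \in shell d k, v != 0 & dist_int (phase v alpha) <= ((2 ^ k)%:R ^+ d)^-1].
    by move=> k; apply: dirichlet => //; rewrite expn_gt0.
  apply: limn_esup_pinfty => K n0.
  (* [2 ^ (- d)] comes from the Fejer coefficients, [2 ^ (- theta)] from [decay_term]. *)
  pose c : R := (2 ^ d)%:R^-1 * (H * 2 `^ (- theta)).
  have c0 : 0 < c by rewrite !mulr_gt0 ?invr_gt0 ?powR_gt0// ltr0n expn_gt0.
  have [n Kn] := harmonic_unbounded (K / c).
  (* Such an [N] satisfies the size condition of [decay_term] for all [k < n] at once. *)
  have [N AN] := infinite_unbounded (maxn n0 ((2 ^ n) ^ d)) A_infinite.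
  rewrite geq_max => /andP[n0N nN]; exists N => //.
  have [M PhiM] := Phi_bounded_support N (A_pos N AN).
  have low := @sup_discrepancy_ge R d (decay d theta) theta H N (Phi N) lam0 lam1 hH M PhiM
     (Phi_sum1 N (A_pos N AN)) (fun t => (Phi_lower N AN t).2) alpha v n.
  have {}low := low (fun k => let: And3 v1 v2 _ := vP k in conj v1 v2).
  have N0 : (0 <= (N%:R `^ theta)%:E)%E by rewrite lee_fin powR_ge0.
  apply: le_trans (lee_wpmul2l N0 low); rewrite -EFinM lee_fin.
  apply: (@le_trans _ _ (c * \sum_(0 <= k < n) k.+1%:R^-1)).
    by rewrite mulrC -ler_pdivrMr.
  rewrite mulrCA /c -mulrA ler_wpM2l ?invr_ge0// !mulr_sumr !big_mkord.
  apply: ler_sum => k _; have [_ _ vk] := vP k.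
  have Dk : ((2 ^ k) ^ d <= N)%N.
    by rewrite (leq_trans _ nN)// leq_exp2r// leq_exp2l// ltnW.
  have := @decay_term R d theta N k (dist_int (phase (v k) alpha)) htheta.
  rewrite dist_int_ge0 vk => /(_ isT Dk) hk.
  have -> : N%:R `^ theta * (amp (decay d theta) k *
      (H * (1 + N%:R * dist_int (phase (v k) alpha)) `^ (- theta))) =
      H * (N%:R `^ theta * (decay d theta ^+ k *
        (1 + N%:R * dist_int (phase (v k) alpha)) `^ (- theta))) * k.+1%:R^-1.
    by rewrite /amp; ring.
  by rewrite ler_wpM2r ?invr_ge0// ler_wpM2l// ltW.
have sob (htheta' : 1 / 2 < theta) delta : 0 <= delta ->
    delta <= d%:R * theta - d%:R / 2 -> in_sobolev delta f.
  move=> delta0 hdelta; apply: extremal_in_sobolev => //.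
  - exact: decay_gt0.
  - exact: decay_sqrt.
  - exact: decay_sobolev.
have d0 : 0 < d%:R :> R by rewrite ltr0n.
split=> [delta delta0 hdelta|htheta'].
  (* The range [0 < delta < d theta - d / 2] is nonempty only if [theta > 1 / 2]. *)
  have htheta' : 1 / 2 < theta by rewrite -(ltr_pM2l d0); lra.
  by exists f; split; [apply: sob => //; exact: ltW|exact: main].
exists f; split; last by apply: aeW => alpha; exact: main.
rewrite -subr_gt0 in htheta'; have := mulr_gt0 d0 htheta'.
by rewrite mulrBr => ?; apply: sob => //; lra.
Qed.
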